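(* The quantum inhomogeneous group $IGL_{q,r}(N)$ is the algebra freely generated by the non-commuting matrix elements $T^A{}_B$ ($A=(0,a)$, $a=1,\dots,N$), the identity $I$ and the inverse $\xi$ of the $q$-determinant of $T$, modulo the relations $$T^0{}_b=0\qquad(b=1,\dots,N)$$ and the $RTT$ relations $$R^{AB}{}_{EF}\,T^E{}_C\,T^F{}_D=T^B{}_F\,T^A{}_E\,R^{EF}{}_{CD},$$ where $R$ is the $R$-matrix of $GL_{q,r}(N+1)$. The co-structures of $IGL_{q,r}(N)$ are given by $$\Delta(T^A{}_B)=T^A{}_C\otimes T^C{}_B,\qquad \kappa(T^A{}_B)=(T^{-1})^A{}_B,\qquad \varepsilon(T^A{}_B)=\delta^A_B .$$
   Context: Indices $A,B,\dots$ run over $\{0,1,\dots,N\}$, lower-case $a,b,\dots$ over $\{1,\dots,N\}$; repeated indices are summed (except in the relations below containing $q_{0a}$, $q_{0c}$, where $a,c$ are free). $r$ and $q_{AB}$ are nonzero complex parameters with $q_{AB}=r^2/q_{BA}$, $q_{AA}=r$. Let $\theta^{AB}=1$ for $A>B$ and $0$ otherwise, and $$R^{AB}{}_{CD}=\delta^A_C\delta^B_D\Big[\frac{r}{q_{AB}}+(r-1)\delta^{AB}\Big]+(r-r^{-1})\,\delta^A_D\delta^B_C\,\theta^{AB};$$ $R^{ab}{}_{cd}$ denotes its restriction to lower-case indices. The $q$-determinant is $$\det T=\sum_\sigma\Big[\prod_{A<B,\ \sigma(A)>\sigma(B)}\Big(-\frac{r^2}{q_{\sigma(B)\sigma(A)}}\Big)\Big]T^0{}_{\sigma(0)}\cdots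 T^N{}_{\sigma(N)}.$$ $IGL_{q,r}(N)$ is the unital algebra generated by $T^A{}_B$, $I$ and the inverse $\xi$ of $\det T$ modulo $T^0{}_a=0$ and, with $x^a=T^a{}_0$, $u=T^0{}_0$, $$R^{ab}{}_{ef}T^e{}_cT^f{}_d=T^b{}_fT^a{}_eR^{ef}{}_{cd},\quad R^{ab}{}_{ef}T^e{}_cx^f=\tfrac{q_{0c}}{r}x^bT^a{}_c,\quad R^{ab}{}_{ef}x^ex^f=r\,x^bx^a,$$ $$q_{0a}T^a{}_cu=q_{0c}\,uT^a{}_c,\qquad q_{0a}x^au=u\,x^a .$$ Equivalently it is the Hopf algebra quotient of $GL_{q,r}(N+1)$ (generated by $T^A{}_B$ and the inverse of $\det T$ modulo the $RTT$ relations) by the Hopf ideal generated by the $T^0{}_a$. The inverse $\xi$ is group-like with $\kappa(\xi)=\det T$. *)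

(* Defs.v *)
From HB Require Import structures.
From mathcomp Require Import all_boot all_order all_algebra perm.
From mathcomp Require Import boolp reals complex.
From mathcomp Require Import finmap monalg.

Set Implicit Arguments.
Unset Strict Implicit.
Unset Printing Implicit Defensive.

Import GRing.Theory.
Local Open Scope ring_scope.
Local Open Scope quotient_scope.

Section SpanQuotient.
Variables (F : fieldType) (V : lmodType F) (P : V -> Prop).

Inductive span : V -> Prop :=
| span_gen x : P x -> span x
| span0 : span 0
| spanD x y : span x -> span y -> span (x + y)
| spanZ c x : span x -> span (c *: x).

Definition span_pred : {pred V} := fun x => `[< span x >].

Lemma span_predP x : reflect (span x) (x \in span_pred).
Proof. exact: asboolP. Qed.

Fact span_zmod_closed : zmod_closed span_pred.
Proof.
split; first exact/span_predP/span0.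
move=> x y /span_predP sx /span_predP sy; apply/span_predP.
by rewrite -scaleN1r; apply: spanD => //; apply: spanZ.
Qed.

HB.instance Definition _ :=
  GRing.isZmodClosed.Build V span_pred span_zmod_closed.

Definition span_quot : Type := Quotient.quot span_pred.

HB.instance Definition _ := GRing.Zmodule.on span_quot.

Definition span_pi (x : V) : span_quot := \pi_(Quotient.quot span_pred) x.

Definition span_repr (u : span_quot) : V := repr (u : Quotient.quot span_pred).

Lemma span_reprK : cancel span_repr span_pi.
Proof. exact: reprK. Qed.

Lemma span_piP x y : span_pi x = span_pi y <-> span (x - y).
Proof.
have /eqP e := Quotient.idealrBE span_pred x y.
split=> [xy|sxy].
  by apply/span_predP; move/eqP: e => ->; apply/eqP.
by apply/eqP; rewrite /span_pi; move/eqP: e => <-; apply/span_predP.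
Qed.

Lemma span_piD : {morph span_pi : x y / x + y}.
Proof. exact: Quotient.pi_add. Qed.

Definition span_quot_scale (c : F) (u : span_quot) : span_quot :=
  span_pi (c *: span_repr u).

Lemma span_piZ c x : span_quot_scale c (span_pi x) = span_pi (c *: x).
Proof.
apply/span_piP; rewrite -scalerBr; apply: spanZ; apply/span_piP.
exact: span_reprK.
Qed.

Fact span_scaleA a b u :
  span_quot_scale a (span_quot_scale b u) = span_quot_scale (a * b) u.
Proof. by rewrite -[u]span_reprK !span_piZ scalerA. Qed.

Fact span_scale1 : left_id 1 span_quot_scale.
Proof. by move=> u; rewrite -[u]span_reprK span_piZ scale1r. Qed.

Fact span_scaleDr : right_distributive span_quot_scale +%R.
Proof.
move=> c u v; rewrite -[u]span_reprK -[v]span_reprK -span_piD !span_piZ.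
by rewrite scalerDr span_piD.
Qed.

Fact span_scaleDl u :
  {morph span_quot_scale^~ u : a b / a + b}.
Proof.
by move=> a b; rewrite /= -[u]span_reprK !span_piZ scalerDl span_piD.
Qed.

HB.instance Definition _ := GRing.Zmodule_isLmodule.Build F span_quot
  span_scaleA span_scale1 span_scaleDr span_scaleDl.

End SpanQuotient.

Section IdealQuotient.
Variables (F : fieldType) (A : algType F) (P : A -> Prop).

(* the two-sided ideal generated by P, as the span of the elements a * p * b *)
Definition ideal_gens (z : A) : Prop :=
  exists a p b : A, P p /\ z = a * p * b.
Definition ideal : A -> Prop := span ideal_gens.

Lemma ideal_mull c x : ideal x -> ideal (c * x).
Proof.
elim=> [z [a [p [b [Pp ->]]]]||y z _ iy _ iz|k y _ iy].
- apply: span_gen; exists (c * a), p, b; split=> //; by rewrite !mulrA.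
- by rewrite mulr0; apply: span0.
- by rewrite mulrDr; apply: spanD.
- by rewrite -scalerAr; apply: spanZ.
Qed.

Lemma ideal_mulr c x : ideal x -> ideal (x * c).
Proof.
elim=> [z [a [p [b [Pp ->]]]]||y z _ iy _ iz|k y _ iy].
- apply: span_gen; exists a, p, (b * c); split=> //; by rewrite !mulrA.
- by rewrite mul0r; apply: span0.
- by rewrite mulrDl; apply: spanD.
- by rewrite -scalerAl; apply: spanZ.
Qed.

(* An algType satisfies 1 != 0, so the ideal is required to be proper. *)
Hypothesis proper : ~ ideal 1.

Definition alg_quot of ~ ideal 1 : Type := span_quot ideal_gens.
Local Notation Q := (alg_quot proper).

HB.instance Definition _ := GRing.Lmodule.on Q.

Definition alg_pi (x : A) : Q := span_pi ideal_gens x.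

Definition alg_quot_mul (u v : Q) : Q :=
  alg_pi (span_repr u * span_repr v).

Lemma alg_piM x y : alg_quot_mul (alg_pi x) (alg_pi y) = alg_pi (x * y).
Proof.
apply/span_piP; set x' := span_repr _; set y' := span_repr _.
have ix : ideal (x' - x) by apply/span_piP; exact: span_reprK.
have iy : ideal (y' - y) by apply/span_piP; exact: span_reprK.
have -> : x' * y' - x * y = (x' - x) * y' + x * (y' - y).
  by rewrite mulrBl mulrBr addrA subrK.
by apply: spanD; [apply: ideal_mulr|apply: ideal_mull].
Qed.

Lemma alg_piD : {morph alg_pi : x y / x + y}.
Proof. exact: span_piD. Qed.

Lemma alg_piZ c x : c *: alg_pi x = alg_pi (c *: x).
Proof. exact: span_piZ. Qed.

Let surj (u : Q) : u = alg_pi (span_repr u).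
Proof. by rewrite /alg_pi span_reprK. Qed.

Fact alg_quot_mulA : associative alg_quot_mul.
Proof.
by move=> u v w; rewrite (surj u) (surj v) (surj w) !alg_piM mulrA.
Qed.
Fact alg_quot_mul1 : left_id (alg_pi 1) alg_quot_mul.
Proof. by move=> u; rewrite (surj u) alg_piM mul1r. Qed.
Fact alg_quot_1mul : right_id (alg_pi 1) alg_quot_mul.
Proof. by move=> u; rewrite (surj u) alg_piM mulr1. Qed.
Fact alg_quot_mulDl : left_distributive alg_quot_mul +%R.
Proof.
move=> u v w; rewrite (surj u) (surj v) (surj w) -alg_piD !alg_piM.
by rewrite mulrDl alg_piD.
Qed.
Fact alg_quot_mulDr : right_distributive alg_quot_mul +%R.
Proof.
move=> u v w; rewrite (surj u) (surj v) (surj w) -alg_piD !alg_piM.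
by rewrite mulrDr alg_piD.
Qed.
Fact alg_quot_one_neq0 : alg_pi 1 != 0.
Proof.
apply/eqP => e; apply: proper; rewrite -[1]subr0; apply/span_piP.
rewrite -[LHS]/(alg_pi 1) e -[RHS]/(alg_pi 0).
by apply: (addrI (alg_pi 0)); rewrite -alg_piD !addr0.
Qed.

HB.instance Definition _ := GRing.Zmodule_isNzRing.Build Q
  alg_quot_mulA alg_quot_mul1 alg_quot_1mul alg_quot_mulDl alg_quot_mulDr
  alg_quot_one_neq0.

Fact alg_quot_scaleAl (c : F) (u v : Q) : c *: (u * v) = (c *: u) * v.
Proof.
rewrite (surj u) (surj v) -[LHS]/(c *: alg_quot_mul _ _) alg_piM !alg_piZ.
by rewrite -[RHS]/(alg_quot_mul _ _) alg_piM scalerAl.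
Qed.
HB.instance Definition _ :=
  GRing.Lmodule_isLalgebra.Build F Q alg_quot_scaleAl.

Fact alg_quot_scaleAr (c : F) (u v : Q) : c *: (u * v) = u * (c *: v).
Proof.
rewrite (surj u) (surj v) -[LHS]/(c *: alg_quot_mul _ _) alg_piM !alg_piZ.
by rewrite -[RHS]/(alg_quot_mul _ _) alg_piM scalerAr.
Qed.
HB.instance Definition _ :=
  GRing.Lalgebra_isAlgebra.Build F Q alg_quot_scaleAr.

End IdealQuotient.

Section FreeAlgebra.
Variables (F : fieldType) (X : choiceType).

Definition freealg : Type := {malg F[{fmonom X}]}.

HB.instance Definition _ := GRing.Lalgebra.on freealg.

Fact freealg_scaleAr (c : F) (x y : freealg) : c *: (x * y) = x * (c *: y).
Proof.
have comm (z : {malg F[{fmonom X}]}) : z * c%:MP = c%:MP * z.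
  rewrite [RHS]mul_malgC malgM_def fgmulgU malgZ_def /fgscale.
  by apply: eq_bigr => k _; rewrite mulm1 mulrC.
have sc (z : freealg) : c *: z = (c%:MP : {malg F[{fmonom X}]}) * z.
  by rewrite mul_malgC.
by rewrite !sc mulrA -[in LHS]comm mulrA.
Qed.

HB.instance Definition _ :=
  GRing.Lalgebra_isAlgebra.Build F freealg freealg_scaleAr.

Definition gen (x : X) : freealg := << fmu x >>.

(* A set of relations l = r is a binary predicate on the free algebra. *)
Definition rel_gens (rel : freealg -> freealg -> Prop) (z : freealg) : Prop :=
  exists l r, rel l r /\ z = l - r.

Lemma ideal_lrmorphism0 (f : {lrmorphism freealg -> F^o}) rel :
  (forall l r, rel l r -> f l = f r) -> ~ ideal (rel_gens rel) 1.
Proof.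
move=> frel i1; suff: f 1 = 0 by apply/eqP; rewrite rmorph1 oner_eq0.
elim: i1 => [z [a [p [b [[l [r [lr ->]]] ->]]]]||x y _ fx _ fy|c x _ fx].
- by rewrite !rmorphM rmorphB /= (frel _ _ lr) subrr mulr0 mul0r.
- by rewrite raddf0.
- by rewrite raddfD /= fx fy addr0.
- by rewrite linearZ /= fx scaler0.
Qed.

End FreeAlgebra.

Section FreeEval.
Variables (F : fieldType) (X : choiceType) (h : X -> F).

Definition monom_eval (m : {fmonom X}) : F := \prod_(x <- m) h x.

Fact monom_eval_mult : mmorphism monom_eval.
Proof.
split=> [m n|]; last by rewrite /monom_eval fm1 big_nil.
by rewrite /monom_eval fmM big_cat.
Qed.
HB.instance Definition _ :=
  isMultiplicative.Build {fmonom X} F monom_eval monom_eval_mult.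

Definition freealg_eval : freealg F X -> F^o := mmap idfun monom_eval.
HB.instance Definition _ := GRing.LRMorphism.copy freealg_eval
   (mmap idfun monom_eval : {malg F[{fmonom X}]} -> F^o).

Lemma freealg_eval_gen x : freealg_eval (gen F x) = h x.
Proof.
by rewrite /freealg_eval /gen mmapU /monom_eval mul1r fmuE big_seq1.
Qed.

Lemma freealg_evalZ c x : freealg_eval (c *: x) = c * freealg_eval x.
Proof. exact: linearZ. Qed.

Lemma freealg_evalM x y :
  freealg_eval (x * y) = freealg_eval x * freealg_eval y.
Proof. exact: rmorphM. Qed.

Lemma freealg_eval_sum (I : finType) (f : I -> freealg F X) :
  freealg_eval (\sum_i f i) = \sum_i freealg_eval (f i).
Proof. exact: raddf_sum. Qed.
End FreeEval.

Section Tensor.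
Variable F : fieldType.

Inductive bilin_rel (U V : lmodType F) : {malg F[(U * V)%type]} -> Prop :=
| bilinDl u u' v :
    bilin_rel (<< (u + u', v) >> - << (u, v) >> - << (u', v) >>)
| bilinZl c u v : bilin_rel (<< (c *: u, v) >> - c *: << (u, v) >>)
| bilinDr u v v' :
    bilin_rel (<< (u, v + v') >> - << (u, v) >> - << (u, v') >>)
| bilinZr c u v : bilin_rel (<< (u, c *: v) >> - c *: << (u, v) >>).

(* U (x) V: the vector space on the pairs (u, v), modulo bilinearity *)
Definition tensor (U V : lmodType F) : lmodType F :=
  span_quot (@bilin_rel U V).

Definition tens (U V : lmodType F) (u : U) (v : V) : tensor U V :=
  span_pi (@bilin_rel U V) << (u, v) >>.

(* The linear map on the tensor product induced by f, for f bilinear;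
   its value is computed on a representative of t. *)
Definition tens_lift (U V W : lmodType F) (f : U -> V -> W)
    (t : tensor U V) : W :=
  let g := span_repr t in \sum_(k <- msupp g) g@_k *: f k.1 k.2.

Definition bilinear2 (U V W : lmodType F) (f : U -> V -> W) : Prop :=
  (forall v, linear (f^~ v)) /\ (forall u, linear (f u)).

Section Lift.
Variables (U V W : lmodType F) (f : U -> V -> W).
Hypothesis bf : bilinear2 f.

Let ext (g : {malg F[(U * V)%type]}) : W :=
  \sum_(k <- msupp g) g@_k *: f k.1 k.2.

Let extw g (d : {fset (U * V)%type}) : (msupp g `<=` d)%fset ->
  ext g = \sum_(k <- d) g@_k *: f k.1 k.2.
Proof.
move=> le; rewrite /ext (big_fset_incl _ le) => //= x xd /mcoeff_outdom ->.
by rewrite scale0r.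
Qed.

Let ext_linear : linear ext.
Proof.
move=> c g1 g2; set d := (msupp g1 `|` msupp g2)%fset.
have le1 : (msupp g1 `<=` d)%fset by apply: fsubsetUl.
have le2 : (msupp g2 `<=` d)%fset by apply: fsubsetUr.
have le : (msupp (c *: g1 + g2) `<=` d)%fset.
  apply: fsubset_trans (msuppD_le _ _) _.
  by apply: fsetSU; apply: msuppZ_le.
rewrite (extw le) (extw le1) (extw le2) scaler_sumr -big_split /=.
by apply: eq_bigr => k _; rewrite mcoeffD mcoeffZ scalerDl scalerA.
Qed.

Let extU u v : ext << (u, v) >> = f u v.
Proof. by rewrite (extw msuppU_le) big_seq_fset1 mcoeffUU scale1r. Qed.

Let extD x y : ext (x + y) = ext x + ext y.
Proof. by have := ext_linear 1 x y; rewrite !scale1r. Qed.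
Let ext0 : ext 0 = 0.
Proof. by apply: (addrI (ext 0)); rewrite -extD !addr0. Qed.
Let extZ c x : ext (c *: x) = c *: ext x.
Proof. by have := ext_linear c x 0; rewrite !addr0 ext0 addr0. Qed.
Let extB x y : ext (x - y) = ext x - ext y.
Proof. by rewrite extD -[- y]scaleN1r extZ scaleN1r. Qed.

Let ext_span g : span (@bilin_rel U V) g -> ext g = 0.
Proof.
have [fl fr] := bf.
elim=> [_ [u u' v|c u v|u v v'|c u v]||x y _ ex _ ey|c x _ ex].
- have := fl v 1 u u'; rewrite !extB !extU !scale1r => ->.
  by rewrite addrAC addrK subrr.
- have e0 : f 0 v = 0.
    by have := fl v (-1) 0 0; rewrite scaler0 addr0 scaleN1r addNr.
  have := fl v c u 0; rewrite extB extZ !extU !addr0 e0 addr0 => ->.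
  by rewrite subrr.
- have := fr u 1 v v'; rewrite !extB !extU !scale1r => ->.
  by rewrite addrAC addrK subrr.
- have e0 : f u 0 = 0.
    by have := fr u (-1) 0 0; rewrite scaler0 addr0 scaleN1r addNr.
  have := fr u c v 0; rewrite extB extZ !extU !addr0 e0 addr0 => ->.
  by rewrite subrr.
- exact: ext0.
- by rewrite extD ex ey addr0.
- by rewrite extZ ex scaler0.
Qed.

Let lift_pi g : tens_lift f (span_pi (@bilin_rel U V) g) = ext g.
Proof.
apply/eqP; rewrite -subr_eq0 -[tens_lift f _]/(ext _) -extB; apply/eqP.
by apply: ext_span; apply/span_piP; apply: span_reprK.
Qed.

Lemma tens_lift_linear : linear (tens_lift f).
Proof.
move=> c s t; rewrite -[s]span_reprK -[t]span_reprK.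
have -> (x y : {malg F[(U * V)%type]}) :
    c *: span_pi (@bilin_rel U V) x + span_pi (@bilin_rel U V) y
    = span_pi (@bilin_rel U V) (c *: x + y).
  by rewrite span_piD -span_piZ.
by rewrite !lift_pi ext_linear.
Qed.

Lemma tens_liftE u v : tens_lift f (tens u v) = f u v.
Proof. by rewrite lift_pi extU. Qed.

End Lift.

Definition tens_map (U V U' V' : lmodType F) (f : U -> U') (g : V -> V') :
    tensor U V -> tensor U' V' :=
  tens_lift (fun u v => tens (f u) (g v)).

Definition tens_assoc (U V W : lmodType F) :
    tensor (tensor U V) W -> tensor U (tensor V W) :=
  tens_lift (fun s w => tens_lift (fun u v => tens u (tens v w)) s).

(* (a (x) b) (a' (x) b') = a a' (x) b b' *)
Definition tens_mul (A B : algType F) (s t : tensor A B) : tensor A B :=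
  tens_lift (fun a b =>
    tens_lift (fun a' b' => tens (a * a') (b * b')) t) s.

End Tensor.

Section Hopf.
Variable F : fieldType.

Record is_hopf (A : algType F)
    (D : A -> tensor A A) (e : A -> F) (k : A -> A) : Prop := IsHopf {
  hopf_D_linear : linear D;
  hopf_D1 : D 1 = tens 1 1;
  hopf_DM : forall x y, D (x * y) = tens_mul (D x) (D y);
  hopf_e_linear : linear (e : A -> F^o);
  hopf_e1 : e 1 = 1;
  hopf_eM : forall x y, e (x * y) = e x * e y;
  hopf_k_linear : linear k;
  hopf_coassoc : forall x,
    tens_assoc (tens_map D id (D x)) = tens_map id D (D x);
  hopf_counitl : forall x, tens_lift (fun a b => e a *: b) (D x) = x;
  hopf_counitr : forall x, tens_lift (fun a b => e b *: a) (D x) = x;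
  hopf_antipodel : forall x, tens_lift (fun a b => k a * b) (D x) = (e x)%:A;
  hopf_antipoder : forall x, tens_lift (fun a b => a * k b) (D x) = (e x)%:A
}.

Record hopf_morphism (A B : algType F)
    (DA : A -> tensor A A) (eA : A -> F) (kA : A -> A)
    (DB : B -> tensor B B) (eB : B -> F) (kB : B -> B)
    (f : {lrmorphism A -> B}) : Prop := HopfMorphism {
  hopf_morphD : forall x, DB (f x) = tens_map f f (DA x);
  hopf_morphe : forall x, eB (f x) = eA x;
  hopf_morphk : forall x, kB (f x) = f (kA x)
}.

End Hopf.

Section QuantumGroup.
Variables (F : fieldType) (N : nat) (r : F) (q : 'I_N.+1 -> 'I_N.+1 -> F).

(* Rmat A B C D is R^{AB}_{CD}. *)
Definition Rmat (A B C D : 'I_N.+1) : F :=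
  (A == C)%:R * (B == D)%:R * (r / q A B + (r - 1) * (A == B)%:R)
  + (r - r^-1) * (A == D)%:R * (B == C)%:R * (B < A)%N%:R.

Definition qdet (H : algType F) (T : 'M[H]_N.+1) : H :=
  \sum_(s : 'S_N.+1)
    (\prod_(A < N.+1) \prod_(B < N.+1 | (A < B)%N && (s B < s A)%N)
       - (r ^+ 2 / q (s B) (s A)))
    *: \prod_(A < N.+1) T A (s A).

(* the generators: Some (A, B) is T^A_B and None is xi *)
Definition qgens : choiceType := option ('I_N.+1 * 'I_N.+1)%type.
Local Notation FA := (freealg F qgens).

Definition freeT : 'M[FA]_N.+1 := \matrix_(A, B) gen F (Some (A, B) : qgens).
Definition freexi : FA := gen F (None : qgens).

(* the index a in {1, ..., N} seen in {0, ..., N} *)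
Definition low (a : 'I_N) : 'I_N.+1 := lift ord0 a.

Inductive det_rel : FA -> FA -> Prop :=
| det_xi : det_rel (qdet freeT * freexi) 1
| xi_det : det_rel (freexi * qdet freeT) 1.

Inductive RTT_rel : FA -> FA -> Prop :=
| RTT A B C D : RTT_rel
    (\sum_E \sum_G Rmat A B E G *: (freeT E C * freeT G D))
    (\sum_E \sum_G Rmat E G C D *: (freeT B G * freeT A E)).

Inductive row0_rel : FA -> FA -> Prop :=
| row0 (b : 'I_N) : row0_rel (freeT ord0 (low b)) 0.

(* the relations among T^a_b, x^a = T^a_0 and u = T^0_0; lower-case indices
   range over {1, ..., N} only, also in the sums *)
Inductive inhom_rel : FA -> FA -> Prop :=
| inhom_TT (a b c d : 'I_N) : inhom_rel
    (\sum_(e < N) \sum_(f < N)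
       Rmat (low a) (low b) (low e) (low f)
         *: (freeT (low e) (low c) * freeT (low f) (low d)))
    (\sum_(e < N) \sum_(f < N)
       Rmat (low e) (low f) (low c) (low d)
         *: (freeT (low b) (low f) * freeT (low a) (low e)))
| inhom_Tx (a b c : 'I_N) : inhom_rel
    (\sum_(e < N) \sum_(f < N)
       Rmat (low a) (low b) (low e) (low f)
         *: (freeT (low e) (low c) * freeT (low f) ord0))
    ((q ord0 (low c) / r) *: (freeT (low b) ord0 * freeT (low a) (low c)))
| inhom_xx (a b : 'I_N) : inhom_rel
    (\sum_(e < N) \sum_(f < N)
       Rmat (low a) (low b) (low e) (low f)
         *: (freeT (low e) ord0 * freeT (low f) ord0))
    (r *: (freeT (low b) ord0 * freeT (low a) ord0))
| inhom_Tu (a c : 'I_N) : inhom_rel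
    (q ord0 (low a) *: (freeT (low a) (low c) * freeT ord0 ord0))
    (q ord0 (low c) *: (freeT ord0 ord0 * freeT (low a) (low c)))
| inhom_xu (a : 'I_N) : inhom_rel
    (q ord0 (low a) *: (freeT (low a) ord0 * freeT ord0 ord0))
    (freeT ord0 ord0 * freeT (low a) ord0).

Definition GL_rel (x y : FA) : Prop := det_rel x y \/ RTT_rel x y.

Definition IGL_rel (x y : FA) : Prop :=
  [\/ det_rel x y, row0_rel x y | inhom_rel x y].

Definition IGL_RTT_rel (x y : FA) : Prop :=
  [\/ det_rel x y, row0_rel x y | RTT_rel x y].

(* Each of the three ideals is killed by the evaluation T^A_B -> delta^A_B,
   xi -> 1, hence is proper. *)

Let h (x : qgens) : F := if x is Some AB then (AB.1 == AB.2)%:R else 1.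
Local Notation ev := (freealg_eval h).

Let evT A B : ev (freeT A B) = (A == B)%:R.
Proof. by rewrite mxE freealg_eval_gen. Qed.
Let evxi : ev freexi = 1.
Proof. by rewrite freealg_eval_gen. Qed.

Let ev_prod (s : 'S_N.+1) :
  ev (\prod_(A < N.+1) freeT A (s A)) = \prod_(A < N.+1) (A == s A)%:R.
Proof. by rewrite rmorph_prod; apply: eq_bigr => A _; apply: evT. Qed.

Let ev_term c (s : 'S_N.+1) :
  ev (c *: \prod_(A < N.+1) freeT A (s A)) = c * \prod_A (A == s A)%:R.
Proof. by rewrite freealg_evalZ ev_prod. Qed.

Let ev_det : ev (qdet freeT) = 1.
Proof.
rewrite /qdet freealg_eval_sum; rewrite (eq_bigr _ (fun s _ => ev_term _ s)).
rewrite (bigD1 (1%g : 'S_N.+1)) //= [X in _ + X]big1 => [|s s1].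
  rewrite addr0 [X in _ * X]big1 => [|A _]; last by rewrite perm1 eqxx.
  rewrite big1 ?mulr1 // => A _; rewrite big1 // => B.
  by rewrite !perm1; case: ltngtP.
have [A sA] : exists A, A != s A.
  apply/existsP; apply: contraNT s1; rewrite negb_exists => /forallP sE.
  by apply/eqP/permP => A; rewrite perm1; have /negPn/eqP <- := sE A.
by rewrite [X in _ * X](bigD1 A) //= (negPf sA) mul0r mulr0.
Qed.

Let low0 a : (low a == ord0) = false.
Proof. by rewrite eq_sym; apply/negbTE/neq_lift. Qed.

Let ev_row0 x y : row0_rel x y -> ev x = ev y.
Proof. by case=> b; rewrite [RHS]raddf0 evT eq_sym low0. Qed.

Let ev_detr x y : det_rel x y -> ev x = ev y.
Proof. by case; rewrite freealg_evalM rmorph1 /= ev_det evxi mul1r. Qed.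

Let evZ c (A B C D : 'I_N.+1) :
  ev (c *: (freeT A B * freeT C D)) = c * ((A == B)%:R * (C == D)%:R).
Proof. by rewrite freealg_evalZ freealg_evalM !evT. Qed.

Let ev_sum2 n (c : 'I_n -> 'I_n -> F) (A B C D : 'I_n -> 'I_n -> 'I_N.+1) :
  ev (\sum_e \sum_g
        c e g *: (freeT (A e g) (B e g) * freeT (C e g) (D e g)))
  = \sum_e \sum_g c e g * ((A e g == B e g)%:R * (C e g == D e g)%:R).
Proof.
rewrite freealg_eval_sum; apply: eq_bigr => e _; rewrite freealg_eval_sum.
by apply: eq_bigr => g _; apply: evZ.
Qed.

Let sum2_delta n (f : 'I_n -> 'I_n -> F) (a b : 'I_n) :
  \sum_e \sum_g f e g * ((e == a)%:R * (g == b)%:R) = f a b.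
Proof.
rewrite (bigD1 a) //= (bigD1 b) //= !eqxx !mulr1 !big1 ?addr0 // => i.
  by move=> ia; rewrite big1 // => g _; rewrite (negPf ia) mul0r mulr0.
by move=> ib; rewrite (negPf ib) !mulr0.
Qed.

Let sum2_delta' n (f : 'I_n -> 'I_n -> F) (a b : 'I_n) :
  \sum_e \sum_g f e g * ((b == g)%:R * (a == e)%:R) = f a b.
Proof.
rewrite -[RHS]sum2_delta; apply: eq_bigr => e _; apply: eq_bigr => g _.
by rewrite [(b == g)%:R * _]mulrC [b == g]eq_sym [a == e]eq_sym.
Qed.

Let low_eq a b : (low a == low b) = (a == b).
Proof. exact: (inj_eq lift_inj). Qed.

Let ev_RTT x y : RTT_rel x y -> ev x = ev y.
Proof.
case=> A B C D; apply: etrans (etrans _ (esym _)).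
- exact: (ev_sum2 (Rmat A B) (fun e _ => e) (fun _ _ => C) (fun _ g => g)
    (fun _ _ => D)).
- rewrite sum2_delta; symmetry.
  exact: (sum2_delta' (fun e g => Rmat e g C D)).
- exact: (ev_sum2 (fun e g => Rmat e g C D) (fun _ _ => B) (fun _ g => g)
    (fun _ _ => A) (fun e _ => e)).
Qed.

Let ev_low (a b : 'I_N) (c d : 'I_N.+1) :
  ev (\sum_(e < N) \sum_(f < N) Rmat (low a) (low b) (low e) (low f)
        *: (freeT (low e) c * freeT (low f) d))
  = \sum_(e < N) \sum_(f < N) Rmat (low a) (low b) (low e) (low f)
        * ((low e == c)%:R * (low f == d)%:R).
Proof.
exact: (ev_sum2 (fun e f => Rmat (low a) (low b) (low e) (low f))
  (fun e _ => low e) (fun _ _ => c) (fun _ f => low f) (fun _ _ => d)).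
Qed.

Let ev_low0 (a b : 'I_N) (c : 'I_N.+1) :
  ev (\sum_(e < N) \sum_(f < N) Rmat (low a) (low b) (low e) (low f)
        *: (freeT (low e) c * freeT (low f) ord0)) = 0.
Proof.
by rewrite ev_low big1 // => e _; rewrite big1 // => f _; rewrite low0 !mulr0.
Qed.

Let low_delta (f : 'I_N -> 'I_N -> F) (a b : 'I_N) :
  \sum_e \sum_g f e g * ((low e == low a)%:R * (low g == low b)%:R) = f a b.
Proof.
rewrite -[RHS]sum2_delta; apply: eq_bigr => e _; apply: eq_bigr => g _.
by rewrite !low_eq.
Qed.

Let low_delta' (f : 'I_N -> 'I_N -> F) (a b : 'I_N) :
  \sum_e \sum_g f e g * ((low b == low g)%:R * (low a == low e)%:R) = f a b.
Proof.
rewrite -[RHS]sum2_delta'; apply: eq_bigr => e _; apply: eq_bigr => g _.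
by rewrite !low_eq.
Qed.

Let ev_inhom x y : inhom_rel x y -> ev x = ev y.
Proof.
case=> [a b c d|a b c|a b|a c|a].
- apply: (etrans (ev_low a b (low c) (low d))).
  apply: (etrans (low_delta
    (fun e f => Rmat (low a) (low b) (low e) (low f)) c d)).
  apply: esym.
  apply: (etrans (ev_sum2
    (fun e f => Rmat (low e) (low f) (low c) (low d))
    (fun _ _ => low b) (fun _ f => low f) (fun _ _ => low a)
    (fun e _ => low e))).
  exact: (low_delta' (fun e f => Rmat (low e) (low f) (low c) (low d))).
- by apply: (etrans (ev_low0 a b (low c))); rewrite evZ low0 mul0r mulr0.
- apply: (etrans (ev_low0 a b ord0)).
  rewrite evZ.
  by rewrite low0 mul0r mulr0.
- apply: (etrans (evZ _ _ _ _ _)); apply: esym.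
  apply: (etrans (evZ _ _ _ _ _)); rewrite eqxx low_eq mulr1 mul1r.
  by case: eqVneq => [->|_]; rewrite ?mulr0.
- by rewrite evZ freealg_evalM !evT low0 mul0r !mulr0.
Qed.

Lemma GL_proper : ~ ideal (rel_gens GL_rel) 1.
Proof.
apply: (@ideal_lrmorphism0 F qgens ev GL_rel) => x y.
by move=> [/ev_detr|/ev_RTT].
Qed.

Lemma IGL_proper : ~ ideal (rel_gens IGL_rel) 1.
Proof.
apply: (@ideal_lrmorphism0 F qgens ev IGL_rel) => x y.
by move=> [/ev_detr|/ev_row0|/ev_inhom].
Qed.

Lemma IGL_RTT_proper : ~ ideal (rel_gens IGL_RTT_rel) 1.
Proof.
apply: (@ideal_lrmorphism0 F qgens ev IGL_RTT_rel) => x y.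
by move=> [/ev_detr|/ev_row0|/ev_RTT].
Qed.

Definition GL : algType F := alg_quot GL_proper.
Definition IGL : algType F := alg_quot IGL_proper.
Definition IGL_RTT : algType F := alg_quot IGL_RTT_proper.

Definition GL_T : 'M[GL]_N.+1 := map_mx (alg_pi GL_proper) freeT.
Definition GL_xi : GL := alg_pi GL_proper freexi.
Definition IGL_T : 'M[IGL]_N.+1 := map_mx (alg_pi IGL_proper) freeT.
Definition IGL_xi : IGL := alg_pi IGL_proper freexi.
Definition IGL_RTT_T : 'M[IGL_RTT]_N.+1 :=
  map_mx (alg_pi IGL_RTT_proper) freeT.
Definition IGL_RTT_xi : IGL_RTT := alg_pi IGL_RTT_proper freexi.


End QuantumGroup.

(* Delta(T^A_B) = T^A_C (x) T^C_B, kappa(T^A_B) = (T^-1)^A_B and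
   epsilon(T^A_B) = delta^A_B; an inverse matrix is unique if it exists. *)
Definition T_costructures (F : fieldType) (H : algType F) (n : nat)
    (T : 'M[H]_n) (D : H -> tensor H H) (e : H -> F) (k : H -> H) : Prop :=
  [/\ forall A B, D (T A B) = \sum_C tens (T A C) (T C B),
      exists Tinv : 'M[H]_n,
        [/\ T *m Tinv = 1%:M, Tinv *m T = 1%:M
          & forall A B, k (T A B) = Tinv A B]
    & forall A B, e (T A B) = (A == B)%:R].

Definition xi_costructures (F : fieldType) (H : algType F) (det xi : H)
    (D : H -> tensor H H) (e : H -> F) (k : H -> H) : Prop :=
  [/\ D xi = tens xi xi, e xi = 1 & k xi = det].

(* Main.v *)
Require Import Defs.
From HB Require Import structures.
From mathcomp Require Import all_boot all_order all_algebra perm.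
From mathcomp Require Import boolp reals complex.
From mathcomp Require Import finmap monalg ring.

Set Implicit Arguments.
Unset Strict Implicit.
Unset Printing Implicit Defensive.

Import GRing.Theory.
Local Open Scope ring_scope.

(** Both presentations of [IGL] describe the same models: a matrix [X] over an
    algebra [B] together with a two-sided inverse [z] of its [q]-determinant,
    subject to the [RTT] relations and to [X^0_b = 0].  Writing out the [RTT]
    relations entry by entry shows that, once [X^0_b = 0], they are equivalent
    to the relations among [T^a_b], [x^a] and [u] ([RTT_inhom], [inhom_RTT]).
    So [GL], [IGL] and [IGL_RTT] are all universal models, with or without the
    condition [X^0_b = 0] ([quot_presented]), and the isomorphism, the
    projection [GL -> IGL] and its kernel follow from universal properties.

    The co-structures are the morphisms given by three models: the identity
    matrix for the counit, the product of the two copies of [T] in the tensor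
    square for the coproduct, and [T^-1] over the opposite algebra, with
    [kappa(xi) = det T], for the antipode.  That these are models rests on the
    [q]-determinant.  Let [e_x] be the generators of the quantum exterior
    algebra, [e_x e_x = 0] and [e_x e_y = - q_xy e_y e_x] for [y < x].  The
    commutation rules of a quantum matrix say that the letters
    [E_i = sum_j X_ij e_j] obey the same rules, and a word in [N + 1] letters of
    an exterior algebra is a scalar multiple of the product of all the letters.
    Hence [sum_g a(g) prod_i X_(f i)(g i) = a(f) det X] for every map [f] of the
    index set to itself, where [a(f)] is the coefficient of the word [f]
    ([qdet_words]).  The exterior algebra acts by creation operators
    on the span of the subsets of the index set, and coefficients are compared
    there.  Three facts follow.

    The determinant is multiplicative on matrices with commuting entries
    ([qdetM]), hence group-like.

    The matrix [T] is invertible ([GL_model_inv]).  Expansion along the rows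
    gives a right inverse.  The transpose of a quantum matrix is a quantum
    matrix for the transposed parameters, with the same determinant, because
    passing from a row-ordered to a column-ordered monomial only exchanges the
    inversions of a permutation, which commute up to scalars ([monomial_tr]);
    so the expansions of the transpose give a left inverse.  If [X^0_b = 0],
    then [(X^-1)^0_b = 0], since the cofactor contains [e_0] twice.

    Over the opposite algebra the determinant of [T^-1] is [xi]
    ([qdet_converse]): the determinant of the product of [T^-1] and [T], formed
    in the tensor product of the opposite algebra with the algebra, contracts
    both to the product of the two determinants and to [1].

    The Hopf axioms are then checked on generators.  For uniqueness, [Delta] and
    [epsilon] are algebra morphisms, determined on [T] because [xi] is an
    inverse of [det T], and the antipode is a convolution inverse. *)

(** * Sorting words of quasi-commuting letters *)

Section Words.
Variables (F : fieldType) (n : nat) (c : 'I_n -> 'I_n -> F).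

(** The coefficient picked up when the word [w] is sorted by exchanges
    [e_x e_y = c x y e_y e_x] for [y < x], subject to [e_x e_x = 0]. *)
Fixpoint word_coef (w : seq 'I_n) : F :=
  if w is x :: w' then
    if x \in w' then 0
    else (\prod_(y <- w' | (y < x)%N) c x y) * word_coef w'
  else 1.

Lemma word_coef_nuniq w : ~~ uniq w -> word_coef w = 0.
Proof.
elim: w => //= x w IH; case: ifP => //= _ /IH ->; exact: mulr0.
Qed.

Lemma word_coef_neq0 w : (forall x y, c x y != 0) -> uniq w ->
  word_coef w != 0.
Proof.
move=> c0; elim: w => [|x w IH] /=; first by rewrite oner_eq0.
case/andP=> /negPf -> /IH ?; rewrite mulf_neq0 //.
by elim/big_rec: _ => [|y p _ ?]; rewrite ?oner_eq0 // mulf_neq0.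
Qed.

Lemma word_coef_map (s : 'I_n -> 'I_n) (t : seq 'I_n) :
  injective s -> sorted (fun i j : 'I_n => (i < j)%N) t ->
  word_coef [seq s i | i <- t]
  = \prod_(A <- t) \prod_(B <- t | (A < B)%N && (s B < s A)%N) c (s A) (s B).
Proof.
move=> s_inj; elim: t => [|x t IH] /=; first by rewrite big_nil.
rewrite (path_sortedE (fun _ _ _ => @ltn_trans _ _ _)).
case/andP=> /allP gt_x /IH ->.
rewrite mem_map //; case: ifP => [/gt_x|_]; first by rewrite /= ltnn.
rewrite big_map big_cons; congr (_ * _).
  rewrite big_cons ltnn /=; rewrite big_seq_cond [RHS]big_seq_cond.
  apply: eq_bigl => B; case Bt: (B \in t) => //=.
  by have /= -> := gt_x _ Bt.
rewrite !big_seq; apply: eq_bigr => A /gt_x /= xA.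
by rewrite [RHS]big_cons ltnNge (ltnW xA).
Qed.

(** The relation [R] tells which pairs of letters satisfy the exchange
    rules: it is full for an exterior algebra, and a linear order when only
    the inversions of a permutation are exchanged. *)
Variables (M : pzRingType) (z : {rmorphism F -> M}) (E : 'I_n -> M).
Variable R : rel 'I_n.
Hypothesis z_central : forall a x, z a * x = x * z a.
Hypothesis E_sq : forall x, R x x -> E x * E x = 0.
Hypothesis E_swap : forall x y : 'I_n, R x y -> (y < x)%N ->
  E x * E y = z (c x y) * (E y * E x).

(** Multiplying a sorted word by one more letter. *)
Lemma ext_insert (P : pred 'I_n) (x : 'I_n) (s : seq 'I_n) :
  (forall y, P y -> R x y) ->
  sorted (fun i j : 'I_n => (i < j)%N) s -> x \in s ->
  E x * \prod_(i <- s | P i) E i =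
  if P x then 0
  else z (\prod_(y <- s | P y && (y < x)%N) c x y)
       * \prod_(i <- s | (i == x) || P i) E i.
Proof.
move=> PR; elim: s => // h s IH /=.
rewrite (path_sortedE (fun _ _ _ => @ltn_trans _ _ _)) in_cons.
case/andP=> /allP gt_h s_sorted.
have [xh _|xh /= xs] := eqVneq x h.
  rewrite -{h}xh in gt_h *; rewrite !big_cons eqxx /= ltnn andbF.
  case: ifP => Px; first by rewrite mulrA E_sq ?mul0r ?PR.
  have -> : \prod_(y <- s | P y && (y < x)%N) c x y = 1.
    rewrite big_seq_cond big_pred0 // => y.
    by case ys: (y \in s) => //=; rewrite ltnNge (ltnW (gt_h _ ys)) andbF.
  rewrite rmorph1 mul1r; congr (_ * _).
  rewrite big_seq_cond [RHS]big_seq_cond.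
  apply: eq_bigl => i; case is_: (i \in s) => //=.
  by case: eqVneq is_ => // -> /gt_h; rewrite /= ltnn.
have hx : (h < x)%N := gt_h _ xs.
rewrite !big_cons hx andbT eq_sym (negPf xh) /=; case: ifP => Ph; last exact: IH.
rewrite mulrA E_swap ?PR // -!mulrA IH //.
case: ifP => _; first by rewrite !mulr0.
by rewrite rmorphM -!mulrA; congr (_ * _); rewrite mulrA -z_central -mulrA.
Qed.

Lemma sorted_enum_ord : sorted (fun i j : 'I_n => (i < j)%N) (enum 'I_n).
Proof.
by have := iota_ltn_sorted 0 n; rewrite -val_enum_ord sorted_map.
Qed.

Lemma prod_enum_ord (P : pred 'I_n) (f : 'I_n -> M) :
  \prod_(i <- enum 'I_n | P i) f i = \prod_(i | P i) f i.
Proof. by rewrite enumT [index_enum _]unlock. Qed.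

Lemma word_insert (P : pred 'I_n) (x : 'I_n) :
  (forall y, P y -> R x y) ->
  E x * \prod_(i | P i) E i =
  if P x then 0
  else z (\prod_(y | P y && (y < x)%N) c x y)
       * \prod_(i | (i == x) || P i) E i.
Proof.
move=> PR; have := ext_insert PR sorted_enum_ord (mem_enum 'I_n x).
by rewrite !prod_enum_ord !big_enum_cond.
Qed.

Lemma word_sort (w : seq 'I_n) : pairwise R w ->
  \prod_(x <- w) E x = z (word_coef w) * \prod_(i | i \in w) E i.
Proof.
elim: w => [|x w IH] /=; first by rewrite big_nil rmorph1 mul1r big_pred0.
case/andP=> /allP Rxw /IH {}IH.
rewrite big_cons IH mulrA -z_central -mulrA word_insert //.
case: ifP => [_|xw]; first by rewrite rmorph0 mulr0 mul0r.
rewrite mulrA -rmorphM; have [w_uniq|/word_coef_nuniq ->] := boolP (uniq w).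
  rewrite [in RHS]mulrC; congr (z (_ * _) * _).
  rewrite -big_filter -[RHS]big_filter; apply: perm_big.
  apply: uniq_perm; rewrite ?filter_uniq ?index_enum_uniq // => y.
  by rewrite !mem_filter mem_index_enum andbT andbC.
by rewrite mul0r mulr0 !rmorph0 !mul0r.
Qed.

(** A word with as many letters as the alphabet is a multiple of the product
    of all the letters. *)
Lemma word_full (w : seq 'I_n) : pairwise R w -> size w = n ->
  \prod_(x <- w) E x = z (word_coef w) * \prod_i E i.
Proof.
move=> Rw sw; rewrite word_sort //.
have [w_uniq|/word_coef_nuniq ->] := boolP (uniq w); last first.
  by rewrite rmorph0 !mul0r.
congr (_ * _); apply: eq_bigl => i.
have sub_enum : {subset w <= enum 'I_n} by move=> y _; rewrite mem_enum.
have [|_ ->] := uniq_min_size w_uniq sub_enum; first by rewrite sw size_enum_ord.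
by rewrite mem_enum.
Qed.

End Words.

(** The coefficient of the word spelled by a function on the alphabet. *)
Definition fun_coef (F : fieldType) n (c : 'I_n -> 'I_n -> F)
  (f : 'I_n -> 'I_n) : F := word_coef c [seq f i | i <- enum 'I_n].

Lemma fun_coef_ninj (F : fieldType) n (c : 'I_n -> 'I_n -> F)
  (f : 'I_n -> 'I_n) : ~~ injectiveb f -> fun_coef c f = 0.
Proof. exact: word_coef_nuniq. Qed.

Lemma fun_coef_perm (F : fieldType) n (c : 'I_n -> 'I_n -> F) (s : 'S_n) :
  fun_coef c s
  = \prod_(A < n) \prod_(B < n | (A < B)%N && (s B < s A)%N) c (s A) (s B).
Proof.
rewrite /fun_coef word_coef_map ?sorted_enum_ord //; last exact: perm_inj.
by rewrite prod_enum_ord; apply: eq_bigr => A _; rewrite prod_enum_ord.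
Qed.

(** * Quantum matrices *)

Lemma scale_eq2 (F : fieldType) (V : lmodType F) (k a b a' b' : F) (x y : V) :
  a *: x = b *: y -> a' = k * a -> b' = k * b -> a' *: x = b' *: y.
Proof. by move=> e -> ->; rewrite -!scalerA e. Qed.

Lemma scale_eq3 (F : fieldType) (V : lmodType F) (k a b c a' b' c' : F)
    (x y w : V) :
  a *: x = b *: y + c *: w -> a' = k * a -> b' = k * b -> c' = k * c ->
  a' *: x = b' *: y + c' *: w.
Proof. by move=> e -> -> ->; rewrite -!scalerA e scalerDr. Qed.

(** The [RTT] relations for a matrix over an arbitrary algebra. *)
Definition RTT_mx (F : fieldType) (N : nat) (r : F)
    (q : 'I_N.+1 -> 'I_N.+1 -> F) (H : algType F) (X : 'M[H]_N.+1) : Prop :=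
  forall A B C D,
    \sum_E \sum_G Rmat r q A B E G *: (X E C * X G D)
    = \sum_E \sum_G Rmat r q E G C D *: (X B G * X A E).

(** The [RTT] relations written out for ordered pairs of rows and columns: the
    commutation rules of a multiparametric quantum matrix. *)
Record qmatrix (F : fieldType) (N : nat) (r : F)
    (q : 'I_N.+1 -> 'I_N.+1 -> F) (H : algType F) (X : 'M[H]_N.+1) : Prop :=
  QMatrix {
  qmx_row : forall A C D : 'I_N.+1, (C < D)%N ->
    X A C * X A D = q D C *: (X A D * X A C);
  qmx_col : forall A B C : 'I_N.+1, (A < B)%N ->
    X A C * X B C = q A B *: (X B C * X A C);
  qmx_anti : forall A B C D : 'I_N.+1, (A < B)%N -> (C < D)%N ->
    X A D * X B C = (q A B / q D C) *: (X B C * X A D);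
  qmx_diag : forall A B C D : 'I_N.+1, (A < B)%N -> (C < D)%N ->
    (r / q A B) *: (X A C * X B D)
    = (r / q C D) *: (X B D * X A C) + (r - r^-1) *: (X B C * X A D)
}.

Section QMatrix.
Variables (F : fieldType) (N : nat) (r : F) (q : 'I_N.+1 -> 'I_N.+1 -> F).
Hypotheses (r_neq0 : r != 0) (q_neq0 : forall A B, q A B != 0)
  (q_inv : forall A B, q A B = r ^+ 2 / q B A) (q_diag : forall A, q A A = r).

(** The entries of [R] vanish except for two index patterns; [h] allows for
    restricting the summation to a subset of the indices. *)
Section RmatSums.
Variables (n : nat) (h : 'I_n -> 'I_N.+1) (V : lmodType F)
  (f : 'I_n -> 'I_n -> V).
Hypothesis h_inj : injective h.

Let sum_pick (c : 'I_n -> 'I_n -> F) (a b : 'I_n) :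
  \sum_e \sum_g ((h a == h e)%:R * (h b == h g)%:R * c e g) *: f e g
  = c a b *: f a b.
Proof.
rewrite (bigD1 a) //= [X in _ + X]big1 ?addr0 => [|e ea]; last first.
  by rewrite big1 // => g _; rewrite (inj_eq h_inj) eq_sym (negPf ea) !mul0r
    scale0r.
rewrite (bigD1 b) //= [X in _ + X]big1 ?addr0 ?eqxx ?mul1r // => g gb.
by rewrite [h b == _]eq_sym !(inj_eq h_inj) (negPf gb) ?mulr0 !mul0r scale0r.
Qed.

Lemma Rmat_suml a b :
  \sum_e \sum_g Rmat r q (h a) (h b) (h e) (h g) *: f e g
  = (r / q (h a) (h b) + (r - 1) * (a == b)%:R) *: f a b
    + ((r - r^-1) * (h b < h a)%N%:R) *: f b a.
Proof.
rewrite -(sum_pick (fun _ _ => r / q (h a) (h b) + (r - 1) * (a == b)%:R)).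
rewrite -(sum_pick (fun _ _ => (r - r^-1) * (h b < h a)%N%:R)) -big_split.
apply: eq_bigr => e _; rewrite -big_split; apply: eq_bigr => g _ /=.
rewrite -scalerDl; congr (_ *: _); rewrite /Rmat !(inj_eq h_inj); ring.
Qed.

Lemma Rmat_sumr c d :
  \sum_e \sum_g Rmat r q (h e) (h g) (h c) (h d) *: f e g
  = (r / q (h c) (h d) + (r - 1) * (c == d)%:R) *: f c d
    + ((r - r^-1) * (h c < h d)%N%:R) *: f d c.
Proof.
rewrite -(sum_pick (fun e g => r / q (h e) (h g) + (r - 1) * (e == g)%:R)).
rewrite -(sum_pick (fun e g => (r - r^-1) * (h g < h e)%N%:R)) -big_split.
apply: eq_bigr => e _; rewrite -big_split; apply: eq_bigr => g _ /=.
rewrite -scalerDl; congr (_ *: _); rewrite /Rmat !(inj_eq h_inj).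
by rewrite [c == e]eq_sym [d == g]eq_sym [d == e]eq_sym [c == g]eq_sym; ring.
Qed.
End RmatSums.

Section Equivalence.
Variables (H : algType F) (X : 'M[H]_N.+1).

Lemma RTT_mxE : RTT_mx r q X <-> forall A B C D,
  (r / q A B + (r - 1) * (A == B)%:R) *: (X A C * X B D)
    + ((r - r^-1) * (B < A)%N%:R) *: (X B C * X A D)
  = (r / q C D + (r - 1) * (C == D)%:R) *: (X B D * X A C)
    + ((r - r^-1) * (C < D)%N%:R) *: (X B C * X A D).
Proof.
have L A B C D := @Rmat_suml _ id H (fun E G => X E C * X G D) (@inj_id _) A B.
have R A B C D := @Rmat_sumr _ id H (fun E G => X B G * X A E) (@inj_id _) C D.
split=> rel A B C D; first by rewrite -L -R.
by rewrite [LHS](L A B C D) [RHS](R A B C D).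
Qed.

Let qr A : r / q A A + (r - 1) * true%:R = r.
Proof. by rewrite q_diag divff // mulr1 addrC subrK. Qed.

Lemma RTT_qmatrix : RTT_mx r q X -> qmatrix r q X.
Proof.
move/RTT_mxE => rel; split=> [A C D CD|A B C AB|A B C D AB CD|A B C D AB CD].
- have := rel A A C D; rewrite eqxx qr ltnn CD mulr0 scale0r addr0 !mulr1.
  move/eqP; rewrite -subr_eq -scalerBl => /eqP.
  rewrite (ltn_eqF CD : (C == D) = false) mulr0 addr0 => e.
  rewrite -[LHS]scale1r; apply: (scale_eq2 (k := r) e); first by field.
  by rewrite q_inv; field.
- have := rel A B C C; rewrite eqxx qr ltnn (ltn_eqF AB : (A == B) = false).
  rewrite [(B < A)%N]ltnNge (ltnW AB) !mulr0 !scale0r !addr0 => e.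
  by rewrite -[LHS]scale1r; apply: (scale_eq2 (k := q A B / r) e); field;
    rewrite ?r_neq0 ?q_neq0.
- have := rel A B D C; rewrite (ltn_eqF AB : (A == B) = false).
  rewrite (gtn_eqF CD : (D == C) = false).
  rewrite [(B < A)%N]ltnNge (ltnW AB) [(D < C)%N]ltnNge (ltnW CD).
  rewrite !mulr0 !scale0r !addr0 => e.
  by rewrite -[LHS]scale1r; apply: (scale_eq2 (k := q A B / r) e); field;
    rewrite ?r_neq0 ?q_neq0.
- have := rel A B C D; rewrite (ltn_eqF AB : (A == B) = false).
  rewrite (ltn_eqF CD : (C == D) = false) CD.
  by rewrite [(B < A)%N]ltnNge (ltnW AB) !mulr0 scale0r !addr0 mulr1.
Qed.

End Equivalence.

(** Transposing a quantum matrix amounts to transposing its parameters. *)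
Lemma qmatrix_trmx (H : algType F) (X : 'M[H]_N.+1) :
  qmatrix r q X -> qmatrix r (fun A B => q B A) X^T.
Proof.
case=> row col anti diag.
split=> [A C D CD|A B C AB|A B C D AB CD|A B C D AB CD]; rewrite !mxE.
- exact: col.
- exact: row.
- rewrite [X C B * _]anti // scalerA -[LHS]scale1r; congr (_ *: _).
  by field; rewrite ?q_neq0.
- rewrite [X C B * _]anti // scalerA.
  apply: (scale_eq3 (k := q C D / q B A) (diag _ _ _ _ CD AB)).
  + by field; rewrite !q_neq0.
  + by rewrite (q_inv D C) (q_inv A B); field; rewrite ?r_neq0 ?q_neq0.
  + exact: mulrC.
Qed.
End QMatrix.

(** * The Fock representation of the exterior algebra *)

Section Fock.
Variables (F : fieldType) (n : nat) (q : 'I_n -> 'I_n -> F).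
Local Notation m := #|{: {set 'I_n}}|.

Let c (x : 'I_n) (S : {set 'I_n}) : F := \prod_(y in S | (y < x)%N) - q x y.

(** The operator creating the letter [x], on the space spanned by the subsets of
    the alphabet; a subset stands for the product of its letters in increasing
    order, and the coefficient comes from moving [x] to its place. *)
Definition fock (x : 'I_n) : 'M[F]_m :=
  \matrix_(i < m, j < m)
    if (x \notin enum_val j) && (enum_val i == x |: enum_val j)
                 then c x (enum_val j) else 0.

Lemma fock_mul x p (M : 'M[F]_(m, p)) i k :
  (fock x *m M) i k =
  \sum_(S : {set 'I_n} | (x \notin S) && (enum_val i == x |: S))
    c x S * M (enum_rank S) k.
Proof.
rewrite mxE (reindex _ (onW_bij _ (@enum_rank_bij {set 'I_n}))) /=.
rewrite [RHS]big_mkcond; apply: eq_bigr => S _.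
by rewrite mxE enum_rankK; case: ifP; rewrite ?mul0r.
Qed.

Lemma fock_sq x : fock x *m fock x = 0.
Proof.
apply/matrixP => i k; rewrite fock_mul mxE big1 // => S /andP[xS _].
rewrite mxE enum_rankK; case: ifP => [/andP[_ /eqP SE]|_]; last exact: mulr0.
by rewrite SE setU11 in xS.
Qed.

Let cU (x y : 'I_n) (S : {set 'I_n}) : y \notin S -> (y < x)%N ->
  c x (y |: S) = - q x y * c x S.
Proof.
move=> yS yx; rewrite /c (bigD1 y) ?setU11 //=; congr (_ * _).
apply: eq_bigl => w; rewrite in_setU1; case: eqVneq => [->|_] /=.
  by rewrite (negPf yS) andbF.
by rewrite andbT.
Qed.

Let cU' (x y : 'I_n) (S : {set 'I_n}) : (y < x)%N -> c y (x |: S) = c y S.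
Proof.
move=> yx; apply: eq_bigl => w; rewrite in_setU1; case: eqVneq => [->|_] //=.
by rewrite ltnNge (ltnW yx) andbF.
Qed.

Let fock_mulE x y i k (S : {set 'I_n} := enum_val k) :
  (fock x *m fock y) i k =
  if [&& x != y, y \notin S, x \notin S & enum_val i == x |: (y |: S)]
  then c x (y |: S) * c y S else 0.
Proof.
rewrite fock_mul; have [xy|xy] /= := eqVneq x y.
  rewrite big1 // => S' /andP[xS' _]; rewrite mxE enum_rankK.
  case: ifP => [/andP[_ /eqP SE]|_]; last exact: mulr0.
  by rewrite SE xy setU11 in xS'.
have [yS|yS] /= := boolP (y \in S).
  by rewrite big1 // => S' _; rewrite mxE enum_rankK yS mulr0.
have [iE|iE] := boolP [&& x \notin S & _]; last first.
  rewrite big1 // => S' /andP[xS' iS']; rewrite mxE enum_rankK yS /=.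
  case: eqP => [SE|_]; last exact: mulr0.
  rewrite SE in_setU1 (negPf xy) /= in xS'; case/negP: iE.
  by rewrite xS' -SE.
case/andP: iE => xS iE; rewrite (bigD1 (y |: S)) /=; last first.
  by rewrite in_setU1 (negPf xy) xS.
rewrite mxE enum_rankK yS eqxx /= big1 ?addr0 // => S' /andP[_ /negPf SE].
by rewrite mxE enum_rankK SE andbF mulr0.
Qed.

Lemma fock_swap (x y : 'I_n) : (y < x)%N ->
  fock x *m fock y = - q x y *: (fock y *m fock x).
Proof.
move=> yx; apply/matrixP => i k; rewrite [RHS]mxE !fock_mulE.
have xy : x != y by rewrite (gtn_eqF yx : (x == y) = false).
rewrite [y == x]eq_sym xy setUCA /=.
rewrite [in RHS]andbA [(_ \notin _) && (y \notin _)]andbC -andbA.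
case: ifP => [/and3P[yS xS _]|_]; last by rewrite mulr0.
by rewrite cU // cU' // -mulrA; congr (_ * _); rewrite mulrC.
Qed.

Lemma fock_enum (s : seq 'I_n) i :
  sorted (fun i j : 'I_n => (i < j)%N) s ->
  (\prod_(x <- s) fock x) i (enum_rank (set0 : {set 'I_n}))
  = (enum_val i == [set x in s])%:R.
Proof.
elim: s i => [|h s IH] i /=.
  move=> _; rewrite big_nil mxE -(inj_eq enum_val_inj) enum_rankK.
  by congr ((_ == _)%:R); apply/setP => x; rewrite !inE.
rewrite (path_sortedE (fun _ _ _ => @ltn_trans _ _ _)).
case/andP=> /allP gt_h s_sorted.
have hs : h \notin [set x in s].
  by rewrite inE; apply/negP => /gt_h; rewrite /= ltnn.
have -> : [set x in h :: s] = h |: [set x in s].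
  by apply/setP => x; rewrite !inE.
rewrite big_cons -[_ * _]/(_ *m _) fock_mul.
rewrite (eq_bigr (fun S => c h S * (S == [set x in s])%:R)) => [|S _]; last first.
  by rewrite IH // enum_rankK.
have [iE|iE] := eqVneq; last first.
  rewrite big1 // => S /andP[_ iS]; case: eqVneq => [SE|]; last by rewrite mulr0.
  by rewrite SE (negPf iE) in iS.
rewrite (bigD1 [set x in s]) /= ?hs ?iE ?eqxx // mulr1 big1 ?addr0.
  rewrite /c big_pred0 // => y; rewrite inE; case ys: (y \in s) => //=.
  by rewrite ltnNge (ltnW (gt_h _ ys)).
by move=> S /andP[_ /negPf ->]; rewrite mulr0.
Qed.

End Fock.

(** * The quantum determinant *)

Lemma sum_alternating (V : zmodType) n (f : 'I_n -> 'I_n -> V) :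
  (forall i, f i i = 0) -> (forall i j : 'I_n, (i < j)%N -> f i j = - f j i) ->
  \sum_i \sum_j f i j = 0.
Proof.
move=> f0 fN.
have -> : \sum_i \sum_j f i j
    = \sum_(i < n) \sum_(j < n | (i < j)%N) f i j
      + \sum_(i < n) \sum_(j < n | (j < i)%N) f i j.
  rewrite -big_split; apply: eq_bigr => i _ /=.
  rewrite (bigID (fun j : 'I_n => (i < j)%N)) /=; congr (_ + _).
  rewrite (bigD1 i) ?ltnn //= f0 add0r; apply: eq_bigl => j.
  by rewrite -leqNgt [(j < i)%N]ltn_neqAle andbC.
rewrite [X in _ + X](exchange_big_dep predT) //= -big_split big1 // => i _.
rewrite -big_split big1 // => j ij /=; by rewrite fN // addNr.
Qed.

Section FockAlgebra.
Variables (F : fieldType) (n : nat) (q : 'I_n -> 'I_n -> F) (H : algType F).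
Local Notation m := #|{: {set 'I_n}}|.
Local Notation M := 'M[H]_m.

(** The scalars, as central matrices over [H]. *)
Definition fock_scalar : F -> M := @scalar_mx H m \o in_alg H.
HB.instance Definition _ := GRing.RMorphism.on fock_scalar.

(** The creation operators with coefficients in [H]. *)
Definition fockH (x : 'I_n) : M := map_mx (in_alg H) (fock q x).

(** The coefficient of the full subset in the image of the vacuum. *)
Definition fock_top (Y : M) : H :=
  Y (enum_rank [set: 'I_n]) (enum_rank (set0 : {set 'I_n})).

Lemma fock_scalar_central a (Y : M) : fock_scalar a * Y = Y * fock_scalar a.
Proof.
apply/matrixP => i j; rewrite -!mulmxE mul_scalar_mx !mxE.
rewrite (bigD1 j) //= big1 => [|k kj]; last by rewrite mxE (negPf kj) mulr0.
by rewrite mxE eqxx mulr1n addr0 -scalerAl mul1r -scalerAr mulr1.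
Qed.

Lemma fockH_comm b x : b%:M * fockH x = fockH x * b%:M.
Proof.
rewrite /fockH; move: (fock q x) => Y; apply/matrixP => i j.
rewrite -!mulmxE mul_scalar_mx !mxE.
rewrite (bigD1 j) //= big1 => [|k kj]; last by rewrite !mxE (negPf kj) mulr0.
by rewrite !mxE eqxx mulr1n addr0 -scalerAl mul1r -scalerAr mulr1.
Qed.

Lemma fockH_sq x : fockH x * fockH x = 0.
Proof. by rewrite -mulmxE -map_mxM fock_sq map_mx0. Qed.

Lemma fockH_swap (x y : 'I_n) : (y < x)%N ->
  fockH x * fockH y = fock_scalar (- q x y) * (fockH y * fockH x).
Proof.
move=> yx; rewrite -!mulmxE -!map_mxM fock_swap // map_mxZ /=.
by rewrite -mul_scalar_mx.
Qed.

Lemma fock_topD : {morph fock_top : Y Z / Y + Z}.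
Proof. by move=> Y Z; rewrite /fock_top mxE. Qed.

Lemma fock_top0 : fock_top 0 = 0.
Proof. by rewrite /fock_top mxE. Qed.

Lemma fock_topM b Y : fock_top (b%:M * Y) = b * fock_top Y.
Proof. by rewrite /fock_top -mulmxE mul_scalar_mx mxE. Qed.

Lemma fock_topZ a Y : fock_top (fock_scalar a * Y) = a *: fock_top Y.
Proof. by rewrite fock_topM -scalerAl mul1r. Qed.

Lemma fock_top_mulr b Y : fock_top (Y * b%:M) = fock_top Y * b.
Proof.
rewrite /fock_top -mulmxE mxE (bigD1 (enum_rank (set0 : {set 'I_n}))) //=.
rewrite mxE eqxx mulr1n big1 ?addr0 // => k /negPf k0.
by rewrite mxE k0 mulr0.
Qed.

Lemma fock_top_prod : fock_top (\prod_x fockH x) = 1.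
Proof.
have -> : \prod_x fockH x = map_mx (in_alg H) (\prod_x fock q x).
  elim/big_rec2: _ => [|x Y Z _ ->]; first by rewrite [RHS]map_mx1.
  by rewrite -[in RHS]/(_ *m _) map_mxM.
rewrite /fock_top mxE -(prod_enum_ord xpredT) fock_enum ?sorted_enum_ord //.
have -> : [set x in enum 'I_n] = [set: 'I_n].
  by apply/setP => x; rewrite !inE mem_enum.
by rewrite enum_rankK eqxx /= scale1r.
Qed.

Lemma fockH_word (f : 'I_n -> 'I_n) :
  fock_top (\prod_i fockH (f i)) = (fun_coef (fun x y => - q x y) f)%:A.
Proof.
have := @word_full F n (fun x y => - q x y) M fock_scalar fockH
  (fun _ _ => true) fock_scalar_central (fun x _ => fockH_sq x)
  (fun x y _ => @fockH_swap x y) [seq f i | i <- enum 'I_n].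
rewrite size_map size_enum_ord big_map prod_enum_ord => -> //.
  by rewrite fock_topZ fock_top_prod.
by elim: [seq f i | i <- _] => //= x w ->; rewrite andbT; apply/allP.
Qed.

(** Products of the generic letters [E_i = sum_j x_ij e_j]. *)
Definition fock_row (X : 'M[H]_n) (i : 'I_n) : M :=
  \sum_j (X i j)%:M * fockH j.

Lemma fock_row_prod (X : 'M[H]_n) (f : 'I_n -> 'I_n) :
  fock_top (\prod_i fock_row X (f i))
  = \sum_(g : {ffun 'I_n -> 'I_n})
      fun_coef (fun x y => - q x y) g *: \prod_i X (f i) (g i).
Proof.
rewrite bigA_distr_bigA /= (big_morph _ fock_topD fock_top0).
apply: eq_bigr => g _.
have -> : \prod_i ((X (f i) (g i))%:M * fockH (g i))
    = (\prod_i X (f i) (g i))%:M * \prod_i fockH (g i).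
  rewrite -!(prod_enum_ord xpredT).
  elim: (enum _) => [|i s IH]; first by rewrite !big_nil mulr1.
  rewrite !big_cons IH rmorphM -!mulrA; congr (_ * _).
  by rewrite mulrA -fockH_comm mulrA.
by rewrite fock_topM fockH_word -scalerAr mulr1.
Qed.

End FockAlgebra.

Section QDet.
Variables (F : fieldType) (N : nat) (r : F) (q : 'I_N.+1 -> 'I_N.+1 -> F).
Hypotheses (r_neq0 : r != 0) (q_neq0 : forall A B, q A B != 0)
  (q_inv : forall A B, q A B = r ^+ 2 / q B A).
Local Notation n := N.+1.
Local Notation c := (fun x y : 'I_n => - q x y).

Let c_neq0 x y : c x y != 0.
Proof. by rewrite oppr_eq0. Qed.

Section Row.
Variables (H : algType F) (X : 'M[H]_n).
Local Notation M := 'M[H]_#|{: {set 'I_n}}|.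
Local Notation E := (fock_row q X).
Local Notation z := (@fock_scalar F n H).

Lemma qdet_ffun :
  \sum_(g : {ffun 'I_n -> 'I_n}) fun_coef c g *: \prod_i X i (g i)
  = qdet r q X.
Proof.
rewrite (bigID (fun g : {ffun _} => injectiveb g)) /= addrC big1 ?add0r.
  rewrite (reindex (@pval _)) /=; last first.
    pose in_Sn := insubd (1%g : 'S_n).
    by exists in_Sn => /= f Uf; first apply: val_inj; apply: insubdK.
  apply: eq_big => /= [s | s _]; rewrite ?(valP s) // pvalE.
  rewrite fun_coef_perm; congr (_ *: _).
  by apply: eq_bigr => A _; apply: eq_bigr => B _; rewrite q_inv.
by move=> f Uf; rewrite fun_coef_ninj ?scale0r.
Qed.

Let pair_sum (b : 'I_n -> 'I_n -> H) :
  (forall C D : 'I_n, (C < D)%N -> b C D = q D C *: b D C) ->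
  \sum_C \sum_D (b C D)%:M * (fockH q H C * fockH q H D) = 0 :> M.
Proof.
move=> bE; apply: sum_alternating => [C|C D CD].
  by rewrite fockH_sq mulr0.
rewrite (fockH_swap q H CD) bE // [X in - X]mulrA -mulNr.
congr (_ * _); rewrite -fock_scalar_central.
rewrite /fock_scalar /= -rmorphM -rmorphN; congr (_%:M).
by rewrite -scalerAl mul1r scaleNr opprK.
Qed.

Let E_mul x y : E x * E y =
  \sum_C \sum_D (X x C * X y D)%:M * (fockH q H C * fockH q H D).
Proof.
rewrite big_distrl; apply: eq_bigr => C _; rewrite big_distrr.
apply: eq_bigr => D _ /=; rewrite rmorphM -!mulrA; congr (_ * _).
by rewrite !mulrA fockH_comm.
Qed.

Hypothesis X_q : qmatrix r q X.

Lemma fock_row_sq x : E x * E x = 0.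
Proof. by rewrite E_mul pair_sum // => C D CD; apply: (qmx_row X_q). Qed.

Lemma fock_row_swap (x y : 'I_n) : (y < x)%N ->
  E x * E y = z (c x y) * (E y * E x).
Proof.
move=> yx; apply/eqP; rewrite -subr_eq0 -mulNr -rmorphN opprK; apply/eqP.
apply: etrans (pair_sum
    (b := fun C D => X x C * X y D + q x y *: (X y C * X x D)) _).
  rewrite !E_mul big_distrr -big_split; apply: eq_bigr => C _.
  rewrite big_distrr -big_split; apply: eq_bigr => D _ /=.
  rewrite [z _ * _]mulrA -mulrDl; congr (_ * _).
  by rewrite /fock_scalar /= -rmorphM -rmorphD /= -scalerAl mul1r.
move=> C D CD; rewrite [X y D * _](qmx_anti X_q yx CD).
have := congr1 (fun t => r *: t) (qmx_diag X_q yx CD).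
rewrite scalerDr !scalerA => e.
rewrite (_ : q x y = r * (r / q y x)); last by rewrite q_inv mulrA.
rewrite e scalerDr !scalerA addrCA; congr (_ + _).
  by congr (_ *: _); rewrite (q_inv D C) mulrA.
rewrite -[X in X + _]scale1r -scalerDl; congr (_ *: _).
by field; rewrite r_neq0 !q_neq0.
Qed.

Let word w : size w = n ->
  \prod_(i <- w) E i = z (word_coef c w) * \prod_i E i.
Proof.
move=> sw; apply: (word_full (R := fun _ _ => true)) => //.
- exact: fock_scalar_central.
- by move=> x _; apply: fock_row_sq.
- by move=> x y _; apply: fock_row_swap.
- by elim: w {sw} => //= x w ->; rewrite andbT; apply/allP.
Qed.

Let top_prod : fock_top (\prod_i E i) = qdet r q X.
Proof. by rewrite -qdet_ffun -(fock_row_prod q X id). Qed.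

(** The rows of a quantum matrix obey the rules of the exterior algebra, so that
    the determinant of the rows [f i] is the coefficient of the word [f] times
    the determinant. *)
Lemma qdet_words (f : 'I_n -> 'I_n) :
  \sum_(g : {ffun 'I_n -> 'I_n}) fun_coef c g *: \prod_i X (f i) (g i)
  = fun_coef c f *: qdet r q X.
Proof.
rewrite -fock_row_prod -top_prod -fock_topZ; congr fock_top.
have := word (w := [seq f i | i <- enum 'I_n]).
by rewrite size_map size_enum_ord big_map prod_enum_ord; apply.
Qed.

(** The indices other than [A], in increasing order. *)
Definition other (A : 'I_n) : seq 'I_n := [seq i <- enum 'I_n | i != A].

Lemma size_other A : size (other A) = N.
Proof.
have := size_rem (mem_enum 'I_n A); rewrite rem_filter ?enum_uniq //.
by rewrite size_enum_ord.
Qed.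

Lemma mem_other A A' : (A' \in other A) = (A' != A).
Proof. by rewrite mem_filter mem_enum andbT. Qed.

(** The cofactors of the expansions along a row, written first for [cof_r] and
    last for [cof_l]. *)
Definition cof_r (B A : 'I_n) : H :=
  fock_top (fockH q H B * \prod_(i <- other A) E i).
Definition cof_l (A B : 'I_n) : H :=
  fock_top (\prod_(i <- other A) E i * fockH q H B).

Lemma laplace_r A A' :
  \sum_B X A B * cof_r B A'
  = if A == A' then word_coef c (A' :: other A') *: qdet r q X else 0.
Proof.
transitivity (fock_top (\prod_(i <- A :: other A') E i)).
  rewrite big_cons big_distrl (big_morph _ (@fock_topD F n H) (@fock_top0 F n H)).
  by apply: eq_bigr => B _; rewrite /= -mulrA fock_topM.
rewrite word /= ?size_other // fock_topZ top_prod mem_other.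
by case: eqVneq => [->|_]; rewrite ?mem_other ?eqxx ?scale0r.
Qed.

Lemma laplace_l A A' :
  \sum_B cof_l A' B * X A B
  = if A == A' then word_coef c (rcons (other A') A') *: qdet r q X else 0.
Proof.
transitivity (fock_top (\prod_(i <- rcons (other A') A) E i)).
  rewrite -cats1 big_cat big_seq1 /= big_distrr.
  rewrite (big_morph _ (@fock_topD F n H) (@fock_top0 F n H)).
  by apply: eq_bigr => B _; rewrite /= fockH_comm mulrA fock_top_mulr.
rewrite word ?size_rcons ?size_other // fock_topZ top_prod.
case: eqVneq => [->|AA'] //.
by rewrite word_coef_nuniq ?scale0r // rcons_uniq mem_other AA'.
Qed.

Variable xi : H.

(** The right inverse given by the cofactors. *)
Definition qinv : 'M[H]_n :=
  \matrix_(B, A) ((word_coef c (A :: other A))^-1 *: (cof_r B A * xi)).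

Lemma mul_qinv : qdet r q X * xi = 1 -> X *m qinv = 1%:M.
Proof.
move=> dx; apply/matrixP => A A'; rewrite !mxE.
transitivity ((word_coef c (A' :: other A'))^-1
              *: ((\sum_B X A B * cof_r B A') * xi)).
  rewrite big_distrl scaler_sumr; apply: eq_bigr => B _.
  by rewrite mxE -scalerAr mulrA.
rewrite laplace_r; case: eqP => _; last by rewrite mul0r scaler0.
rewrite -scalerAl dx scalerA mulVf ?scale1r // word_coef_neq0 //.
by rewrite cons_uniq mem_other eqxx filter_uniq ?enum_uniq.
Qed.

(** The expansion with the row written last inverts the transpose on the left. *)
Lemma qinv_l : xi * qdet r q X = 1 ->
  exists S : 'M[H]_n, forall A A', \sum_B S A' B * X A B = (A == A')%:R.
Proof.
move=> dx; exists (\matrix_(A, B)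
  ((word_coef c (rcons (other A) A))^-1 *: (xi * cof_l A B))) => A A'.
transitivity ((word_coef c (rcons (other A') A'))^-1
              *: (xi * (\sum_B cof_l A' B * X A B))).
  rewrite big_distrr scaler_sumr; apply: eq_bigr => B _.
  by rewrite mxE -scalerAl -mulrA.
rewrite laplace_l; case: eqP => _; last by rewrite mulr0 scaler0.
rewrite -scalerAr dx scalerA mulVf ?scale1r // word_coef_neq0 //.
by rewrite rcons_uniq mem_other eqxx filter_uniq ?enum_uniq.
Qed.

(** The first row of the inverse vanishes with the first row of [X], off the
    diagonal: the cofactors involved contain [e_0] twice. *)
Lemma qinv_row0 : (forall b : 'I_N, X ord0 (low b) = 0) ->
  forall b : 'I_N, qinv ord0 (low b) = 0.
Proof.
move=> X0 b; have oE : other (low b) = ord0 :: behead (other (low b)).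
  by rewrite /other enum_ordSl.
rewrite mxE /cof_r [X in fock_top X](_ : _ = fockH q H ord0 *
  (E ord0 * \prod_(i <- behead (other (low b))) E i)); last first.
  by rewrite oE big_cons.
have -> : E ord0 = (X ord0 ord0)%:M * fockH q H ord0.
  rewrite /fock_row big_ord_recl big1 ?addr0 // => i _.
  by rewrite [X _ _]X0 rmorph0 mul0r.
by rewrite mulrA mulrA -fockH_comm -!mulrA [fockH _ _ _ * (_ * _)]mulrA
  fockH_sq mul0r mulr0 fock_top0 mul0r scaler0.
Qed.

End Row.

(** The determinant of a product of matrices with commuting entries. *)
Lemma qdetM (H : algType F) (X Y : 'M[H]_n) :
  (forall A B C D, X A B * Y C D = Y C D * X A B) -> qmatrix r q Y ->
  qdet r q (X *m Y) = qdet r q X * qdet r q Y.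
Proof.
move=> XY Yq; rewrite -(qdet_ffun (_ *m _)) -(qdet_ffun X) big_distrl /=.
transitivity (\sum_(g : {ffun 'I_n -> 'I_n}) \sum_(f : {ffun 'I_n -> 'I_n})
    (\prod_i X i (f i)) * (fun_coef c g *: \prod_i Y (f i) (g i))).
  apply: eq_bigr => g _; rewrite (eq_bigr (fun i => \sum_j X i j * Y j (g i)));
    last by move=> i _; rewrite mxE.
  rewrite bigA_distr_bigA scaler_sumr; apply: eq_bigr => f _ /=.
  rewrite -scalerAr; congr (_ *: _).
  rewrite -!(prod_enum_ord xpredT).
  elim: (enum _) => [|i s IH]; first by rewrite !big_nil mulr1.
  rewrite !big_cons IH -!mulrA; congr (_ * _); rewrite !mulrA; congr (_ * _).
  elim: s {IH} => [|j s IH]; first by rewrite !big_nil mulr1 mul1r.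
  by rewrite !big_cons -mulrA -IH !mulrA XY.
rewrite exchange_big; apply: eq_bigr => f _ /=.
by rewrite -big_distrr /= qdet_words // -scalerAr scalerAl.
Qed.

End QDet.

Section Transpose.
Variables (F : fieldType) (N : nat) (r : F) (q : 'I_N.+1 -> 'I_N.+1 -> F).
Hypotheses (r_neq0 : r != 0) (q_neq0 : forall A B, q A B != 0)
  (q_inv : forall A B, q A B = r ^+ 2 / q B A).
Variables (H : algType F) (X : 'M[H]_N.+1).
Hypothesis X_q : qmatrix r q X.
Local Notation n := N.+1.

(** In a monomial of the determinant, the factors that have to be exchanged to
    pass from the order of the rows to that of the columns are those of the
    inversions of the permutation, which commute up to a scalar. *)
Lemma monomial_tr (s : 'S_n) :
  \prod_A X A (s A)
  = (\prod_(A < n) \prod_(B < n | (A < B)%N && (s B < s A)%N)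
       (q A B / q (s A) (s B))) *: \prod_A X (s^-1%g A) A.
Proof.
pose c x y := q (s^-1%g x) (s^-1%g y) / q x y.
pose R : rel 'I_n := fun x y => (s^-1%g x < s^-1%g y)%N.
have w : \prod_A X (s^-1%g (s A)) (s A)
    = in_alg H (fun_coef c s) * \prod_A X (s^-1%g A) A.
  have := @word_full F n c H (in_alg H) (fun j => X (s^-1%g j) j) R _ _ _
    [seq s i | i <- enum 'I_n].
  rewrite size_map size_enum_ord big_map prod_enum_ord => -> //.
  - by move=> a x; rewrite -scalerAl mul1r -scalerAr mulr1.
  - by move=> x; rewrite /R ltnn.
  - move=> x y Rxy yx; rewrite -scalerAl mul1r; exact: (qmx_anti X_q).
  - rewrite pairwise_map; apply: sub_pairwise (_ : pairwise
      (fun i j : 'I_n => (i < j)%N) _) => [x y|]; first by rewrite /R /= !permK.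
    rewrite -(sorted_pairwise (fun _ _ _ => @ltn_trans _ _ _)).
    exact: sorted_enum_ord.
rewrite (eq_bigr _ (fun A _ => congr1 (X^~ (s A)) (esym (permK s A)))) /= w.
rewrite fun_coef_perm -scalerAl mul1r /c; congr (_ *: _).
by apply: eq_bigr => A _; apply: eq_bigr => B _; rewrite !permK.
Qed.

Lemma qdet_tr : qdet r q X = qdet r (fun A B => q B A) X^T.
Proof.
have inv_inj : injective (fun s : 'S_n => s^-1%g) by exact: invg_inj.
rewrite /qdet [RHS](reindex_inj inv_inj) /=; apply: eq_bigr => s _.
rewrite monomial_tr scalerA; congr (_ *: _); last first.
  by apply: eq_bigr => A _; rewrite mxE.
rewrite [RHS](reindex_inj (@perm_inj _ s)) /=.
under [RHS]eq_bigr => A _.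
  rewrite (reindex_inj (@perm_inj _ s)) /=.
  under eq_bigl => B do rewrite !permK.
  under eq_bigr => B _ do rewrite !permK.
  over.
rewrite [RHS](exchange_big_dep xpredT) //= -big_split; apply: eq_bigr => A _ /=.
rewrite -big_split; apply: eq_big => [B|B _] /=; first by rewrite andbC.
by rewrite -q_inv mulNr mulrCA mulfV ?mulr1 // -q_inv.
Qed.
End Transpose.

(** * Tensor products of algebras *)

Section TensorTheory.
Variable F : fieldType.
Implicit Types U V W : lmodType F.

Lemma linear_lin U V (f : U -> V) : linear f ->
  [/\ {morph f : x y / x + y}, forall c, {morph f : x / c *: x} & f 0 = 0].
Proof.
move=> lf; have fD : {morph f : x y / x + y}.
  by move=> x y; have := lf 1 x y; rewrite !scale1r.
have f0 : f 0 = 0 by apply: (addrI (f 0)); rewrite -fD !addr0.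
by split=> // c x; have := lf c x 0; rewrite !addr0 f0 addr0.
Qed.

Lemma tens_bilinear U V : bilinear2 (@tens F U V).
Proof.
have piD (x y w : {malg F[(U * V)%type]}) :
    bilin_rel (x - y - w) ->
    span_pi (@bilin_rel F U V) x
    = span_pi (@bilin_rel F U V) y + span_pi (@bilin_rel F U V) w.
  move=> rel; rewrite -span_piD; apply/span_piP.
  by rewrite opprD addrA; apply: span_gen.
have piZ (x y : {malg F[(U * V)%type]}) c :
    bilin_rel (x - c *: y) ->
    span_pi (@bilin_rel F U V) x = c *: span_pi (@bilin_rel F U V) y.
  move=> rel; rewrite -[c *: _]/(span_quot_scale c _) span_piZ.
  by apply/span_piP; apply: span_gen.
split=> [v c u u'|u c v v']; rewrite /tens.
- by rewrite (piD _ _ _ (bilinDl _ _ _)) (piZ _ _ _ (bilinZl _ _ _)).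
- by rewrite (piD _ _ _ (bilinDr _ _ _)) (piZ _ _ _ (bilinZr _ _ _)).
Qed.

Section Tens.
Variables U V : lmodType F.
Implicit Types (u : U) (v : V).

Lemma tensDl u u' v : tens (u + u') v = tens u v + tens u' v.
Proof. by have [+ _ _] := linear_lin ((tens_bilinear U V).1 v); apply. Qed.
Lemma tensDr u v v' : tens u (v + v') = tens u v + tens u v'.
Proof. by have [+ _ _] := linear_lin ((tens_bilinear U V).2 u); apply. Qed.
Lemma tensZl c u v : tens (c *: u) v = c *: tens u v.
Proof. by have [_ + _] := linear_lin ((tens_bilinear U V).1 v); apply. Qed.
Lemma tensZr c u v : tens u (c *: v) = c *: tens u v.
Proof. by have [_ + _] := linear_lin ((tens_bilinear U V).2 u); apply. Qed.
Lemma tens0l v : tens (0 : U) v = 0.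
Proof. by have [_ _] := linear_lin ((tens_bilinear U V).1 v). Qed.
Lemma tens0r u : tens u (0 : V) = 0.
Proof. by have [_ _] := linear_lin ((tens_bilinear U V).2 u). Qed.

(** Pure tensors span the tensor product. *)
Lemma tensor_ind (P : tensor U V -> Prop) :
  (forall u v, P (tens u v)) -> (forall s t, P s -> P t -> P (s + t)) ->
  (forall c t, P t -> P (c *: t)) -> forall t, P t.
Proof.
move=> Ptens PD PZ t; rewrite -[t]span_reprK; move: (span_repr t) => g.
rewrite [g]monalgE.
have P0 : P 0 by rewrite -(tens0l (0 : V)); apply: Ptens.
elim: (enum_fset (msupp g)) => [|k s IH].
  rewrite big_nil; suff -> : span_pi (@bilin_rel F U V) 0 = 0 by [].
  by apply: (addrI (span_pi (@bilin_rel F U V) 0)); rewrite -span_piD !addr0.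
rewrite big_cons span_piD; apply: PD => //.
have -> : << g@_k *g k >> = g@_k *: << k >>.
  by apply/malgP => k'; rewrite mcoeffZ !mcoeffU; case: eqP; rewrite ?mulr1 ?mulr0.
rewrite -span_piZ; apply: PZ; case: k => u v; exact: Ptens.
Qed.
End Tens.

End TensorTheory.

Section TensorLift.
Variable F : fieldType.
Implicit Types U V W : lmodType F.

Lemma tensor_ext U V W (f g : tensor U V -> W) : linear f -> linear g ->
  (forall u v, f (tens u v) = g (tens u v)) -> f =1 g.
Proof.
move=> /linear_lin[fD fZ _] /linear_lin[gD gZ _] fg t.
by elim/tensor_ind: t => [u v|s t fs ft|c t ft] //; rewrite ?fD ?gD ?fZ ?gZ ?fs ?ft.
Qed.

(** The map induced by [f] also depends linearly on [f]. *)
Lemma tens_lift_comb U V W (f g h : U -> V -> W) c t :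
  (forall u v, f u v = c *: g u v + h u v) ->
  tens_lift f t = c *: tens_lift g t + tens_lift h t.
Proof.
move=> fE; rewrite /tens_lift scaler_sumr -big_split; apply: eq_bigr => k _ /=.
by rewrite fE scalerDr !scalerA mulrC.
Qed.

Lemma eq_tens_lift U V W (f g : U -> V -> W) t :
  (forall u v, f u v = g u v) -> tens_lift f t = tens_lift g t.
Proof. by move=> fg; apply: eq_bigr => k _; rewrite fg. Qed.

Lemma lin_comp U V W (f : U -> V) (g : V -> W) :
  linear f -> linear g -> linear (fun x => g (f x)).
Proof. by move=> lf lg c x y; rewrite lf lg. Qed.

Lemma lin_id U : linear (id : U -> U).
Proof. by []. Qed.

Section Map.
Variables (U V U' V' : lmodType F) (f : U -> U') (g : V -> V').
Hypotheses (lf : linear f) (lg : linear g).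

Lemma tens_map_bilinear : bilinear2 (fun u v => tens (f u) (g v)).
Proof.
by split=> [v|u] c x y; rewrite (lf, lg) (tensDl, tensDr) (tensZl, tensZr).
Qed.

Lemma tens_map_linear : linear (tens_map f g).
Proof. exact: tens_lift_linear tens_map_bilinear. Qed.

Lemma tens_mapE u v : tens_map f g (tens u v) = tens (f u) (g v).
Proof. exact: tens_liftE tens_map_bilinear _ _. Qed.
End Map.

Section Assoc.
Variables (U V W : lmodType F).

Lemma tens_assoc_bilinear1 w :
  bilinear2 (fun (u : U) (v : V) => tens u (tens v (w : W))).
Proof.
split=> [v|u] c x y; first by rewrite tensDl tensZl.
by rewrite tensDl tensZl tensDr tensZr.
Qed.

Lemma tens_assoc_bilinear : bilinear2
  (fun (s : tensor U V) (w : W) =>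
    tens_lift (fun u v => tens u (tens v w)) s).
Proof.
split=> [w|s c w w']; first exact: tens_lift_linear (tens_assoc_bilinear1 w).
by apply: tens_lift_comb => u v; rewrite !tensDr !tensZr.
Qed.

Lemma tens_assoc_linear : linear (@tens_assoc F U V W).
Proof. exact: tens_lift_linear tens_assoc_bilinear. Qed.

Lemma tens_assocE u v w :
  tens_assoc (tens (tens u v) w) = tens u (tens v w) :> tensor U (tensor V W).
Proof.
rewrite /tens_assoc (tens_liftE tens_assoc_bilinear).
exact: tens_liftE (tens_assoc_bilinear1 w) _ _.
Qed.
End Assoc.

Section Mul.
Variables A B : algType F.

Lemma tens_mul_bilinear1 (a : A) (b : B) :
  bilinear2 (fun a' b' => tens (a * a') (b * b')).
Proof.
split=> [b'|a'] c x y; first by rewrite mulrDr -scalerAr tensDl tensZl.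
by rewrite mulrDr -scalerAr tensDr tensZr.
Qed.

Lemma tens_mul_bilinear2 (t : tensor A B) : bilinear2 (fun a b =>
    tens_lift (fun a' b' => tens (a * a') (b * b')) t).
Proof.
split=> [b|a] c x y; apply: tens_lift_comb => a' b'.
  by rewrite mulrDl -scalerAl tensDl tensZl.
by rewrite mulrDl -scalerAl tensDr tensZr.
Qed.

Lemma tens_mul_bilinear : bilinear2 (@tens_mul F A B).
Proof.
split=> [t|s c t t']; first exact: tens_lift_linear (tens_mul_bilinear2 t).
apply: tens_lift_comb => a b.
exact: tens_lift_linear (tens_mul_bilinear1 a b) _ _ _.
Qed.

Lemma tens_mulE a b a' b' :
  tens_mul (tens a b) (tens a' b') = tens (a * a') (b * b') :> tensor A B.
Proof.
rewrite /tens_mul (tens_liftE (tens_mul_bilinear2 _)).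
exact: tens_liftE (tens_mul_bilinear1 a b) _ _.
Qed.

Let lml t : linear (fun s => @tens_mul F A B s t).
Proof. exact: tens_mul_bilinear.1. Qed.
Let lmr s : linear (@tens_mul F A B s).
Proof. exact: tens_mul_bilinear.2. Qed.

Lemma tens_mulA : associative (@tens_mul F A B).
Proof.
move=> s t u.
apply: (tensor_ext (f := fun s => tens_mul s (tens_mul t u))
  (g := fun s => tens_mul (tens_mul s t) u)) => [|| a b].
- exact: lml.
- exact: lin_comp (lml t) (lml u).
apply: (tensor_ext (f := fun t => tens_mul (tens a b) (tens_mul t u))
  (g := fun t => tens_mul (tens_mul (tens a b) t) u)) => [|| a' b'].
- exact: lin_comp (lml u) (lmr _).
- exact: lin_comp (lmr _) (lml u).
apply: (tensor_ext (f := fun u => tens_mul (tens a b) (tens_mul (tens a' b') u))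
  (g := fun u => tens_mul (tens_mul (tens a b) (tens a' b')) u)) => [|| x y].
- exact: lin_comp (lmr _) (lmr _).
- exact: lmr.
by rewrite !tens_mulE !mulrA.
Qed.

Lemma tens_mul1 : left_id (tens 1 1) (@tens_mul F A B).
Proof.
apply: tensor_ext => [||a b]; first exact: lmr; first exact: lin_id.
by rewrite tens_mulE !mul1r.
Qed.

Lemma tens_1mul : right_id (tens 1 1) (@tens_mul F A B).
Proof.
apply: tensor_ext => [||a b]; first exact: lml; first exact: lin_id.
by rewrite tens_mulE !mulr1.
Qed.

Lemma tens_mulDl : left_distributive (@tens_mul F A B) +%R.
Proof. by move=> s t u; have [-> _ _] := linear_lin (lml u). Qed.
Lemma tens_mulDr : right_distributive (@tens_mul F A B) +%R.
Proof. by move=> s t u; have [-> _ _] := linear_lin (lmr s). Qed.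

(** The tensor product of two algebras, as an algebra; it has to be nonzero. *)
Definition tens_alg of tens 1 1 != 0 :> tensor A B : Type := tensor A B.

Section Instance.
Hypothesis nz : tens 1 1 != 0 :> tensor A B.
Local Notation TA := (tens_alg nz).

HB.instance Definition _ := GRing.Lmodule.on TA.
HB.instance Definition _ := GRing.Zmodule_isNzRing.Build TA
  tens_mulA tens_mul1 tens_1mul tens_mulDl tens_mulDr nz.

Fact tens_scaleAl (c : F) (s t : TA) : c *: (s * t) = (c *: s) * t.
Proof. have [_ lZ _] := linear_lin (lml t); exact/esym/lZ. Qed.
HB.instance Definition _ := GRing.Lmodule_isLalgebra.Build F TA tens_scaleAl.

Fact tens_scaleAr (c : F) (s t : TA) : c *: (s * t) = s * (c *: t).
Proof. have [_ rZ _] := linear_lin (lmr s); exact/esym/rZ. Qed.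
HB.instance Definition _ := GRing.Lalgebra_isAlgebra.Build F TA tens_scaleAr.
End Instance.

End Mul.

(** Applying algebra morphisms factorwise is multiplicative. *)
Lemma tens_mapM (A B A' B' : algType F) (f : A -> A') (g : B -> B') s t :
  linear f -> linear g -> {morph f : x y / x * y} ->
  {morph g : x y / x * y} ->
  tens_map f g (tens_mul s t)
  = tens_mul (tens_map f g s) (tens_map f g t).
Proof.
move=> lf lg fM gM; have lfg := tens_map_linear lf lg.
have lml (A1 B1 : algType F) (t : tensor A1 B1) := (@tens_mul_bilinear A1 B1).1 t.
have lmr (A1 B1 : algType F) (t : tensor A1 B1) := (@tens_mul_bilinear A1 B1).2 t.
apply: (tensor_ext (f := fun s => tens_map f g (tens_mul s t))
  (g := fun s => tens_mul (tens_map f g s) (tens_map f g t))) => [|| a b].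
- exact: lin_comp (lml _ _ t) lfg.
- exact: lin_comp lfg (lml _ _ _).
apply: (tensor_ext (f := fun t => tens_map f g (tens_mul (tens a b) t))
  (g := fun t => tens_mul (tens_map f g (tens a b)) (tens_map f g t)))
  => [|| a' b'].
- exact: lin_comp (lmr _ _ _) lfg.
- exact: lin_comp lfg (lmr _ _ _).
by rewrite !(tens_mulE, tens_mapE lf lg) fM gM.
Qed.

End TensorLift.

(** * Presentations of algebras *)

Section FreeLift.
Variables (F : fieldType) (X : choiceType) (B : algType F) (h : X -> B).

(** The value of a word, given the values of its letters. *)
Definition monom_lift (m : {fmonom X}) : B := \prod_(x <- m) h x.

Fact monom_lift_mult : mmorphism monom_lift.
Proof.
split=> [u v|]; last by rewrite /monom_lift fm1 big_nil.
by rewrite /monom_lift fmM big_cat.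
Qed.
HB.instance Definition _ :=
  isMultiplicative.Build {fmonom X} B monom_lift monom_lift_mult.

(** The algebra morphism extending a map on the free generators. *)
Definition free_lift : freealg F X -> B := mmap (in_alg B) monom_lift.

Fact free_lift_linear : linear free_lift.
Proof.
move=> c x y; rewrite /free_lift raddfD /= mmapZ /=.
by rewrite -scalerAl mul1r.
Qed.
HB.instance Definition _ :=
  GRing.isLinear.Build F (freealg F X) B *:%R free_lift free_lift_linear.

Fact free_lift_mult : monoid_morphism free_lift.
Proof.
have [|fM f1] := @commr_mmap_is_multiplicative _ _ _ (in_alg B) monom_lift.
  by move=> g u v; rewrite /GRing.comm /= -scalerAl mul1r -scalerAr mulr1.
by split.
Qed.
HB.instance Definition _ :=
  GRing.isMonoidMorphism.Build (freealg F X) B free_lift free_lift_mult.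

Lemma free_lift_gen x : free_lift (gen F x) = h x.
Proof.
by rewrite /free_lift /gen mmapU /= scale1r mul1r /monom_lift fmuE big_seq1.
Qed.
End FreeLift.

(** The free algebra is generated by its generators. *)
Lemma freealg_ind (F : fieldType) (X : choiceType) (P : freealg F X -> Prop) :
  P 1 -> (forall x y, P x -> P y -> P (x + y)) ->
  (forall c x, P x -> P (c *: x)) -> (forall x y, P x -> P y -> P (x * y)) ->
  (forall x, P (gen F x)) -> forall x, P x.
Proof.
move=> P1 PD PZ PM Pg x; rewrite [x]monalgE.
have P0 : P 0 by rewrite -(scale0r 1); apply: PZ.
elim: (enum_fset (msupp x)) => [|k s IH]; first by rewrite big_nil.
rewrite big_cons; apply: PD => //.
have -> : << x@_k *g k >> = x@_k *: (<< k >> : freealg F X).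
  by apply/malgP => k'; rewrite mcoeffZ !mcoeffU; case: eqP; rewrite ?mulr1 ?mulr0.
apply: PZ; case: k => k; elim: k => [|a k Pk].
  by rewrite (_ : << _ >> = 1) // -fmoneE.
rewrite (_ : << FMonom (a :: k) >> = gen F a * << FMonom k >>); first exact: PM.
rewrite [RHS]malgM_def /gen fgmulUU mulr1 fmuE; congr (<< _ >>).
exact: esym (fmmulE (FMonom [:: a]) (FMonom k)).
Qed.

Section QuotLift.
Variables (F : fieldType) (A B : algType F) (P : A -> Prop).
Hypothesis proper : ~ ideal P 1.
Variable f : {lrmorphism A -> B}.
Hypothesis fP : forall x, P x -> f x = 0.

Lemma ideal_lrmorphism x : ideal P x -> f x = 0.
Proof.
elim=> [z [a [p [b [Pp ->]]]]||y z _ iy _ iz|k y _ iy].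
- by rewrite !rmorphM /= (fP Pp) mulr0 mul0r.
- by rewrite raddf0.
- by rewrite raddfD /= iy iz addr0.
- by rewrite linearZ /= iy scaler0.
Qed.

(** The morphism induced on a quotient algebra. *)
Definition quot_lift of (forall x, P x -> f x = 0) :
  alg_quot proper -> B := fun u => f (span_repr u).
Local Notation g := (quot_lift fP).

Lemma quot_liftE x : g (alg_pi proper x) = f x.
Proof.
apply/eqP; rewrite -subr_eq0 -raddfB; apply/eqP/ideal_lrmorphism/span_piP.
exact: span_reprK.
Qed.

Fact quot_lift_linear : linear g.
Proof.
move=> c u v; rewrite -[u]span_reprK -[v]span_reprK.
rewrite -[span_pi _ (span_repr u)]/(alg_pi proper _).
rewrite -[span_pi _ (span_repr v)]/(alg_pi proper _).
by rewrite alg_piZ -alg_piD !quot_liftE linearP.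
Qed.
HB.instance Definition _ :=
  GRing.isLinear.Build F (alg_quot proper) B *:%R g quot_lift_linear.

Fact quot_lift_mult : monoid_morphism g.
Proof.
split=> [|u v]; first exact: etrans (quot_liftE 1) (rmorph1 f).
rewrite -[u]span_reprK -[v]span_reprK.
rewrite -[span_pi _ (span_repr u)]/(alg_pi proper _).
rewrite -[span_pi _ (span_repr v)]/(alg_pi proper _).
by rewrite -[_ * _ in LHS]/(alg_quot_mul _ _) alg_piM !quot_liftE rmorphM.
Qed.
HB.instance Definition _ :=
  GRing.isMonoidMorphism.Build (alg_quot proper) B g quot_lift_mult.

Lemma alg_quot_lift :
  exists g' : {lrmorphism alg_quot proper -> B},
    forall x, g' (alg_pi proper x) = f x.
Proof. by exists g; apply: quot_liftE. Qed.
End QuotLift.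

(** The projection onto a quotient algebra is an algebra morphism. *)
Section QuotPi.
Variables (F : fieldType) (A : algType F) (P : A -> Prop).
Hypothesis proper : ~ ideal P 1.
Local Notation pi := (alg_pi proper).

Fact alg_pi_linear : linear pi.
Proof. by move=> c x y; rewrite alg_piD alg_piZ. Qed.
HB.instance Definition _ :=
  GRing.isLinear.Build F A (alg_quot proper) *:%R pi alg_pi_linear.

Fact alg_pi_mult : monoid_morphism pi.
Proof. by split=> // x y; rewrite -[RHS]/(alg_quot_mul _ _) alg_piM. Qed.
HB.instance Definition _ :=
  GRing.isMonoidMorphism.Build A (alg_quot proper) pi alg_pi_mult.

Lemma alg_pi_eq0 x : pi x = 0 <-> ideal P x.
Proof.
rewrite -[0](raddf0 pi) /alg_pi; split=> [/span_piP|ix]; first by rewrite subr0.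
by apply/span_piP; rewrite subr0.
Qed.

Lemma alg_pi_surj u : exists x, pi x = u.
Proof. by exists (span_repr u); apply: span_reprK. Qed.
End QuotPi.

(** The opposite algebra. *)
Section Converse.
Variables (F : fieldType) (H : algType F).
HB.instance Definition _ := GRing.Lmodule.on H^c.
Fact converse_scaleAl (c : F) (u v : H^c) :
  c *: (u * v) = (c *: u : H^c) * v.
Proof. exact: (@scalerAr F H c v u). Qed.
HB.instance Definition _ :=
  GRing.Lmodule_isLalgebra.Build F H^c converse_scaleAl.
Fact converse_scaleAr (c : F) (u v : H^c) :
  c *: (u * v) = u * (c *: v : H^c).
Proof. exact: (@scalerAl F H c v u). Qed.
HB.instance Definition _ :=
  GRing.Lalgebra_isAlgebra.Build F H^c converse_scaleAr.
End Converse.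

(** * Models of the quantum group relations *)

Section PairMatrices.
Variables (F : fieldType) (N : nat) (r : F) (q : 'I_N.+1 -> 'I_N.+1 -> F).
Local Notation I := 'I_N.+1.
Local Notation K := (I * I)%type.

(** Matrices indexed by pairs, as functions. *)
Definition pmul (H : algType F) (U V : K -> K -> H) : K -> K -> H :=
  fun x y => \sum_k U x k * V k y.
Definition pid (H : algType F) : K -> K -> H := fun x y => (x == y)%:R.
(** In terms of pairs, the [RTT] relations read [R T_1 T_2 = T_2 T_1 R]: [pR] is
    the matrix [R], [p12] is [X_1 X_2] and [p21] is [X_2 X_1]. *)
Definition pR (H : algType F) : K -> K -> H :=
  fun x y => (Rmat r q x.1 x.2 y.1 y.2)%:A.
Definition p12 (H : algType F) (X : 'M[H]_N.+1) : K -> K -> H :=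
  fun x y => X x.1 y.1 * X x.2 y.2.
Definition p21 (H : algType F) (X : 'M[H]_N.+1) : K -> K -> H :=
  fun x y => X x.2 y.2 * X x.1 y.1.

Section Ring.
Variable H : algType F.
Implicit Types (U V W : K -> K -> H) (X Y : 'M[H]_N.+1).

Lemma pmulA U V W : pmul U (pmul V W) = pmul (pmul U V) W.
Proof.
apply: funext => x; apply: funext => y; rewrite /pmul.
under eq_bigr => k _ do rewrite big_distrr.
rewrite exchange_big; apply: eq_bigr => l _; rewrite big_distrl.
by apply: eq_bigr => k _ /=; rewrite mulrA.
Qed.

Lemma pmul1 U : pmul U (@pid H) = U.
Proof.
apply: funext => x; apply: funext => y; rewrite /pmul (bigD1 y) //=.
rewrite /pid eqxx mulr1 big1 ?addr0 // => k /negPf ->; exact: mulr0.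
Qed.

Lemma p1mul U : pmul (@pid H) U = U.
Proof.
apply: funext => x; apply: funext => y; rewrite /pmul (bigD1 x) //=.
by rewrite /pid eqxx mul1r big1 ?addr0 // => k; rewrite eq_sym => /negPf ->;
  rewrite mul0r.
Qed.

Lemma RTT_pair X :
  RTT_mx r q X <-> pmul (@pR H) (p12 X) = pmul (p21 X) (@pR H).
Proof.
have L A B C D : pmul (@pR H) (p12 X) (A, B) (C, D)
    = \sum_E \sum_G Rmat r q A B E G *: (X E C * X G D).
  rewrite [RHS]pair_bigA; apply: eq_bigr => k _ /=.
  by rewrite -scalerAl mul1r.
have R A B C D : pmul (p21 X) (@pR H) (A, B) (C, D)
    = \sum_E \sum_G Rmat r q E G C D *: (X B G * X A E).
  rewrite [RHS]pair_bigA; apply: eq_bigr => k _ /=.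
  by rewrite -scalerAr mulr1.
split=> [rel|e A B C D]; last by rewrite -L -R e.
by apply: funext => -[A B]; apply: funext => -[C D]; rewrite L R.
Qed.

Lemma p12M X Y : (forall A B C D, X A B * Y C D = Y C D * X A B) ->
  p12 (X *m Y) = pmul (p12 X) (p12 Y).
Proof.
move=> XY; apply: funext => -[A B]; apply: funext => -[C D].
rewrite /p12 /pmul /= !mxE big_distrlr /= pair_bigA.
by apply: eq_bigr => -[E G] _ /=; rewrite -!mulrA; congr (_ * _);
  rewrite !mulrA XY.
Qed.

Lemma p21M X Y : (forall A B C D, X A B * Y C D = Y C D * X A B) ->
  p21 (X *m Y) = pmul (p21 X) (p21 Y).
Proof.
move=> XY; apply: funext => -[A B]; apply: funext => -[C D].
rewrite /p21 /pmul /= !mxE big_distrlr /= exchange_big pair_bigA.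
by apply: eq_bigr => -[E G] _ /=; rewrite -!mulrA; congr (_ * _);
  rewrite !mulrA XY.
Qed.

(** Quantum matrices with commuting entries can be multiplied. *)
Lemma RTT_mul X Y : (forall A B C D, X A B * Y C D = Y C D * X A B) ->
  RTT_mx r q X -> RTT_mx r q Y -> RTT_mx r q (X *m Y).
Proof.
move=> XY /RTT_pair RX /RTT_pair RY; apply/RTT_pair.
by rewrite p12M // p21M // pmulA RX -pmulA RY pmulA.
Qed.

Lemma p12_inv X Y : X *m Y = 1%:M -> pmul (p12 X) (p21 Y) = @pid H.
Proof.
move=> XY; apply: funext => -[A B]; apply: funext => -[C D].
have e A' C' : \sum_j X A' j * Y j C' = (A' == C')%:R.
  by have /matrixP/(_ A' C') := XY; rewrite !mxE.
rewrite /pmul /p12 /p21 /pid -(pair_bigA _ (fun E G =>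
  X A E * X B G * (Y G D * Y E C))) /=.
transitivity (\sum_E X A E * ((\sum_G X B G * Y G D) * Y E C)).
  apply: eq_bigr => E _; rewrite big_distrl big_distrr.
  by apply: eq_bigr => G _ /=; rewrite !mulrA.
rewrite e xpair_eqE; case: (B == D) => /=; last first.
  by rewrite andbF big1 // => E _; rewrite mul0r mulr0.
by rewrite andbT -e; apply: eq_bigr => E _; rewrite mul1r.
Qed.

(** The inverse of a quantum matrix is a quantum matrix over the opposite
    algebra. *)
Lemma RTT_inv X Y : X *m Y = 1%:M -> Y *m X = 1%:M ->
  RTT_mx r q X -> @RTT_mx F N r q H^c Y.
Proof.
move=> XY YX /RTT_pair RX.
have e : pmul (p12 Y) (@pR H) = pmul (@pR H) (p21 Y).
  rewrite -[LHS]pmul1 -(p12_inv XY) -!pmulA [pmul (@pR H) (pmul _ _)]pmulA RX.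
  by rewrite !pmulA p12_inv // p1mul.
move=> A B C D.
have /(congr1 (fun f => f (A, B) (C, D))) := e; rewrite /pmul => e'.
rewrite !pair_bigA; apply: etrans (etrans (esym e') _).
  by apply: eq_bigr => -[E G] _; rewrite /pR /= -scalerAl mul1r.
by apply: eq_bigr => -[E G] _; rewrite /pR /= -scalerAr mulr1.
Qed.
End Ring.
End PairMatrices.

Section TensorFactors.
Variables (F : fieldType) (A B : algType F).
Hypothesis nz : tens 1 1 != 0 :> tensor A B.
Local Notation TA := (tens_alg nz).

Lemma tens_algM a b a' b' :
  (tens a b : TA) * (tens a' b' : TA) = (tens (a * a') (b * b') : TA).
Proof. exact: tens_mulE. Qed.

(** The embeddings of the two factors of a tensor product. *)
Definition tens_inl : A -> TA := fun a => tens a 1.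
Definition tens_inr : B -> TA := fun b => tens 1 b.
Local Notation il := tens_inl.
Local Notation ir := tens_inr.

Fact tens_inl_linear : linear il.
Proof. by move=> c x y; rewrite /tens_inl tensDl tensZl. Qed.
HB.instance Definition _ := GRing.isLinear.Build F A TA *:%R il tens_inl_linear.
Fact tens_inl_mult : monoid_morphism il.
Proof. by split=> // x y; rewrite tens_algM mulr1. Qed.
HB.instance Definition _ := GRing.isMonoidMorphism.Build A TA il tens_inl_mult.

Fact tens_inr_linear : linear ir.
Proof. by move=> c x y; rewrite /tens_inr tensDr tensZr. Qed.
HB.instance Definition _ := GRing.isLinear.Build F B TA *:%R ir tens_inr_linear.
Fact tens_inr_mult : monoid_morphism ir.
Proof. by split=> // x y; rewrite tens_algM mulr1. Qed.
HB.instance Definition _ := GRing.isMonoidMorphism.Build B TA ir tens_inr_mult.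

Lemma tens_inlr a b : il a * ir b = tens a b.
Proof. by rewrite tens_algM mulr1 mul1r. Qed.

Lemma tens_inlrC a b : il a * ir b = ir b * il a.
Proof. by rewrite !tens_algM !mulr1 !mul1r. Qed.
End TensorFactors.

Section Models.
Variables (F : fieldType) (N : nat) (r : F) (q : 'I_N.+1 -> 'I_N.+1 -> F).
Hypotheses (r_neq0 : r != 0) (q_neq0 : forall A B, q A B != 0)
  (q_inv : forall A B, q A B = r ^+ 2 / q B A) (q_diag : forall A, q A A = r).
Local Notation n := N.+1.

(** A matrix and an element of an algebra subject to the relations between the
    generators of [GL_{q,r}(N+1)]. *)
Definition GL_model (H : algType F) (X : 'M[H]_n) (z : H) : Prop :=
  [/\ RTT_mx r q X, qdet r q X * z = 1 & z * qdet r q X = 1].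

(** The condition [X^0_b = 0]. *)
Definition row0_mx (H : algType F) (X : 'M[H]_n) : Prop :=
  forall b : 'I_N, X ord0 (low b) = 0.

Lemma qdet_map (H H' : algType F) (f : {lrmorphism H -> H'}) (X : 'M[H]_n) :
  f (qdet r q X) = qdet r q (map_mx f X).
Proof.
rewrite /qdet raddf_sum; apply: eq_bigr => s _.
rewrite /= linearZ /= rmorph_prod; congr (_ *: _).
by apply: eq_bigr => A _; rewrite mxE.
Qed.

Lemma RTT_map (H H' : algType F) (f : {lrmorphism H -> H'}) (X : 'M[H]_n) :
  RTT_mx r q X -> RTT_mx r q (map_mx f X).
Proof.
move=> RX A B C D; have := congr1 f (RX A B C D).
rewrite !raddf_sum => e; apply: etrans (etrans e _); last first.
  apply: eq_bigr => E _; rewrite raddf_sum; apply: eq_bigr => G _.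
  by rewrite /= linearZ /= rmorphM !mxE.
apply: eq_bigr => E _; rewrite raddf_sum; apply: eq_bigr => G _.
by rewrite /= linearZ /= rmorphM !mxE.
Qed.

Lemma GL_model_map (H H' : algType F) (f : {lrmorphism H -> H'})
    (X : 'M[H]_n) z : GL_model X z -> GL_model (map_mx f X) (f z).
Proof.
by case=> RX dz zd; split; first exact: RTT_map;
  rewrite -qdet_map -rmorphM ?dz ?zd rmorph1.
Qed.

(** The rows of [X] give a right inverse, those of its transpose a left one. *)
Lemma GL_model_inv (H : algType F) (X : 'M[H]_n) z : GL_model X z ->
  X *m qinv q X z = 1%:M /\ qinv q X z *m X = 1%:M.
Proof.
case=> /(RTT_qmatrix r_neq0 q_neq0 q_inv q_diag) Xq dz zd.
have XS : X *m qinv q X z = 1%:M by apply: (mul_qinv (r := r)).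
have Xq' := qmatrix_trmx r_neq0 q_neq0 q_inv Xq.
have dt := qdet_tr q_neq0 q_inv Xq; rewrite dt in zd.
have qi A B : (fun A B => q B A) A B = r ^+ 2 / (fun A B => q B A) B A.
  exact: q_inv.
have [S SX] := qinv_l r_neq0 (fun A B => q_neq0 B A) qi Xq' zd.
have {}SX : S *m X = 1%:M.
  apply/matrixP => A B; have := SX B A; rewrite !mxE eq_sym => <-.
  by apply: eq_bigr => C _; rewrite mxE.
have SE : S = qinv q X z by rewrite -[LHS]mulmx1 -XS mulmxA SX mul1mx.
by split=> //; rewrite -SE.
Qed.

Lemma qdet1 (H : algType F) : qdet r q (1%:M : 'M[H]_n) = 1.
Proof.
rewrite /qdet (bigD1 (1%g : 'S_n)) //= [X in _ + X]big1 => [|s s1].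
  rewrite addr0 big1 => [|A _]; last first.
    by rewrite big1 // => B; rewrite !perm1; case: ltngtP.
  by rewrite scale1r big1 // => A _; rewrite mxE perm1 eqxx.
have [A sA] : exists A, A != s A.
  apply/existsP; apply: contraNT s1; rewrite negb_exists => /forallP sE.
  by apply/eqP/permP => A; rewrite perm1; have /negPn/eqP <- := sE A.
suff -> : \prod_(i < n) (1%:M : 'M[H]_n) i (s i) = 0 by rewrite scaler0.
rewrite -(prod_enum_ord xpredT); have : A \in enum 'I_n by rewrite mem_enum.
elim: (enum _) => // i t IH; rewrite in_cons big_cons => /orP[/eqP <-|/IH ->].
  by rewrite mxE (negPf sA) mul0r.
exact: mulr0.
Qed.

Lemma RTT_1 (H : algType F) : RTT_mx r q (1%:M : 'M[H]_n).
Proof.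
apply/RTT_pair; have e12 : p12 (1%:M : 'M[H]_n) = @pid F N H.
  apply: funext => -[A B]; apply: funext => -[C D].
  by rewrite /p12 /pid !mxE xpair_eqE -natrM mulnb.
have e21 : p21 (1%:M : 'M[H]_n) = @pid F N H.
  apply: funext => -[A B]; apply: funext => -[C D].
  by rewrite /p21 /pid !mxE xpair_eqE -natrM mulnb andbC.
by rewrite e12 e21 pmul1 p1mul.
Qed.

Lemma GL_model1 (H : algType F) : GL_model (1%:M : 'M[H]_n) 1.
Proof. by split; rewrite ?qdet1 ?mulr1 //; apply: RTT_1. Qed.

(** Models with commuting entries can be multiplied. *)
Lemma GL_modelM (H : algType F) (X Y : 'M[H]_n) zX zY z :
  (forall A B C D, X A B * Y C D = Y C D * X A B) ->
  GL_model X zX -> GL_model Y zY ->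
  qdet r q X * qdet r q Y * z = 1 -> z * (qdet r q X * qdet r q Y) = 1 ->
  GL_model (X *m Y) z.
Proof.
move=> XY [RX _ _] [RY _ _].
have Yq := RTT_qmatrix r_neq0 q_neq0 q_inv q_diag RY.
by split; rewrite ?(qdetM r_neq0 q_neq0 q_inv) //; apply: RTT_mul.
Qed.
End Models.

(** * Contractions of tensor products of algebras *)

Section Contractions.
Variable F : fieldType.

Lemma lin_sum (U V : lmodType F) (f : U -> V) (I : Type) (s : seq I)
    (P : pred I) (g : I -> U) :
  linear f -> f (\sum_(i <- s | P i) g i) = \sum_(i <- s | P i) f (g i).
Proof. by case/linear_lin=> fD _ f0; apply: big_morph. Qed.

Lemma linear_tens_lift (U V W W' : lmodType F) (f : U -> V -> W)
    (g : W -> W') t :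
  linear g -> g (tens_lift f t) = tens_lift (fun u v => g (f u v)) t.
Proof.
move=> lg; rewrite /tens_lift lin_sum //; apply: eq_bigr => k _.
by have [_ -> _] := linear_lin lg.
Qed.

Lemma contract_bilinear (U V : lmodType F) (C : algType F) (f : U -> C)
    (g : V -> C) : linear f -> linear g ->
  bilinear2 (fun a b => f a * g b).
Proof.
move=> lf lg; split=> [b|a] c x y; first by rewrite lf mulrDl scalerAl.
by rewrite lg mulrDr scalerAr.
Qed.

Variables A B C : algType F.

(** If [f] is multiplicative in the opposite order, contracting a product whose
    left factor contracts to a scalar only leaves the other factor. *)
Lemma contract_mull (f : A -> C) (g : B -> C) s t c :
  linear f -> linear g ->
  (forall x y, f (x * y) = f y * f x) -> (forall x y, g (x * y) = g x * g y) ->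
  tens_lift (fun a b => f a * g b) s = c%:A ->
  tens_lift (fun a b => f a * g b) (tens_mul s t)
  = c *: tens_lift (fun a b => f a * g b) t.
Proof.
move=> lf lg fM gM sc; have bfg := contract_bilinear lf lg.
have lfg := tens_lift_linear bfg.
move: t; apply: tensor_ext => [||a' b'].
- exact: lin_comp ((@tens_mul_bilinear F A B).2 _) lfg.
- by move=> k x y; rewrite lfg scalerDr !scalerA mulrC.
transitivity (f a' * tens_lift (fun a b => f a * g b) s * g b').
  move: s {sc}; apply: tensor_ext => [||a b].
  - exact: lin_comp ((@tens_mul_bilinear F A B).1 _) lfg.
  - by move=> k x y; rewrite lfg mulrDr mulrDl -scalerAr -scalerAl.
  by rewrite tens_mulE !tens_liftE // fM gM !mulrA.
by rewrite sc tens_liftE // -scalerAr mulr1 -scalerAl.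
Qed.

Lemma contract_mulr (f : A -> C) (g : B -> C) s t c :
  linear f -> linear g ->
  (forall x y, f (x * y) = f x * f y) -> (forall x y, g (x * y) = g y * g x) ->
  tens_lift (fun a b => f a * g b) t = c%:A ->
  tens_lift (fun a b => f a * g b) (tens_mul s t)
  = c *: tens_lift (fun a b => f a * g b) s.
Proof.
move=> lf lg fM gM tc; have bfg := contract_bilinear lf lg.
have lfg := tens_lift_linear bfg.
move: s; apply: tensor_ext => [||a b].
- exact: lin_comp ((@tens_mul_bilinear F A B).1 _) lfg.
- by move=> k x y; rewrite lfg scalerDr !scalerA mulrC.
transitivity (f a * tens_lift (fun a b => f a * g b) t * g b).
  move: t {tc}; apply: tensor_ext => [||a' b'].
  - exact: lin_comp ((@tens_mul_bilinear F A B).2 _) lfg.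
  - by move=> k x y; rewrite lfg mulrDr mulrDl -scalerAr -scalerAl.
  by rewrite tens_mulE !tens_liftE // fM gM !mulrA.
by rewrite tc tens_liftE // -scalerAr mulr1 -scalerAl.
Qed.

Lemma tens_liftM (h : A -> B -> C) s t : bilinear2 h ->
  (forall a b a' b', h (a * a') (b * b') = h a b * h a' b') ->
  tens_lift h (tens_mul s t) = tens_lift h s * tens_lift h t.
Proof.
move=> bh hM; have lh := tens_lift_linear bh.
move: s; apply: tensor_ext => [||a b].
- exact: lin_comp ((@tens_mul_bilinear F A B).1 _) lh.
- by move=> k x y; rewrite lh mulrDl scalerAl.
move: t; apply: tensor_ext => [||a' b'].
- exact: lin_comp ((@tens_mul_bilinear F A B).2 _) lh.
- by move=> k x y; rewrite lh mulrDr scalerAr.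
by rewrite tens_mulE !tens_liftE.
Qed.

Lemma tens_assocM (nzl : tens 1 1 != 0 :> tensor A B)
    (nzr : tens 1 1 != 0 :> tensor B C)
    (s t : tensor (tensor A B) C) :
  tens_assoc (@tens_mul F (tens_alg nzl) C s t)
  = @tens_mul F A (tens_alg nzr) (tens_assoc s) (tens_assoc t).
Proof.
have la := @tens_assoc_linear F A B C.
have lml t' := (@tens_mul_bilinear F (tens_alg nzl) C).1 t'.
have lmr s' := (@tens_mul_bilinear F (tens_alg nzl) C).2 s'.
have rml t' := (@tens_mul_bilinear F A (tens_alg nzr)).1 t'.
have rmr s' := (@tens_mul_bilinear F A (tens_alg nzr)).2 s'.
have lt (U V : lmodType F) (v : V) : linear (fun u : U => tens u v).
  exact: (tens_bilinear U V).1.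
move: s; apply: tensor_ext => [||s c].
- exact: lin_comp (lml t) la.
- exact: lin_comp la (rml _).
move: t; apply: tensor_ext => [||t c'].
- exact: lin_comp (lmr _) la.
- exact: lin_comp la (rmr _).
move: s; apply: tensor_ext => [||a b].
- exact: lin_comp (lin_comp (lt _ _ c) (lml _)) la.
- exact: lin_comp (lin_comp (lt _ _ c) la) (rml _).
move: t; apply: tensor_ext => [||a' b'].
- exact: lin_comp (lin_comp (lt _ _ c') (lmr _)) la.
- exact: lin_comp (lin_comp (lt _ _ c') la) (rmr _).
have e1 : @tens_mul F (tens_alg nzl) C (tens (tens a b) c) (tens (tens a' b') c')
    = tens (tens (a * a') (b * b')) (c * c').
  apply: etrans (tens_mulE (A := tens_alg nzl) _ _ _ _) _.
  exact: (congr1 (fun s : tensor A B => @tens F (tens_alg nzl) C s (c * c'))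
    (tens_mulE a b a' b')).
have e2 : @tens_mul F A (tens_alg nzr) (tens a (tens b c)) (tens a' (tens b' c'))
    = tens (a * a') (tens (b * b') (c * c')).
  apply: etrans (tens_mulE (B := tens_alg nzr) _ _ _ _) _.
  exact: (congr1 (fun s : tensor B C => @tens F A (tens_alg nzr) (a * a') s)
    (tens_mulE b c b' c')).
apply: etrans (congr1 (@tens_assoc F A B C) e1) _.
apply: etrans (tens_assocE _ _ _) _; apply: esym.
apply: etrans (congr2 (@tens_mul F A (tens_alg nzr))
  (tens_assocE a b c) (tens_assocE a' b' c')) _.
exact: e2.
Qed.

End Contractions.

Section ConverseModel.
Variables (F : fieldType) (N : nat) (r : F) (q : 'I_N.+1 -> 'I_N.+1 -> F).
Hypotheses (r_neq0 : r != 0) (q_neq0 : forall A B, q A B != 0)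
  (q_inv : forall A B, q A B = r ^+ 2 / q B A) (q_diag : forall A, q A A = r).
Variables (H : algType F) (X : 'M[H]_N.+1) (z : H).
Hypothesis Xz : GL_model r q X z.
Local Notation S := (qinv q X z).

(** The contraction [mu] multiplies the two factors, back in [H]. *)
Let opid : H^c -> H := fun a => a.
Let idH : H -> H := fun a => a.
Let mu : tensor H^c H -> H := tens_lift (fun a b => opid a * idH b).

Let lopid : linear opid. Proof. by []. Qed.
Let lidH : linear idH. Proof. by []. Qed.
Let bmu := contract_bilinear lopid lidH.
Let lmu : linear mu := tens_lift_linear bmu.
Let muE a b : mu (tens a b) = opid a * b.
Proof. exact: tens_liftE bmu _ _. Qed.

Let nz : tens 1 1 != 0 :> tensor H^c H.
Proof.
apply/eqP => t0; have := muE 1 1; rewrite t0 mulr1.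
have [_ _ ->] := linear_lin lmu; apply/eqP.
by rewrite eq_sym; apply: (oner_neq0 H).
Qed.

Let mu_prod (Y : 'M[tens_alg nz]_N.+1) (f : 'I_N.+1 -> 'I_N.+1) :
  (forall A B, mu (Y A B) = (A == B)%:R) ->
  mu (\prod_A Y A (f A)) = \prod_A (1%:M : 'M[H]_N.+1) A (f A).
Proof.
move=> muY; rewrite -!(prod_enum_ord xpredT).
elim: (enum _) => [|A s IH]; first by rewrite !big_nil [LHS]muE mulr1.
rewrite !big_cons.
have e : mu (Y A (f A)) = ((A == f A)%:R : F)%:A.
  by rewrite muY; case: (_ == _); rewrite ?scale1r ?scale0r.
rewrite [LHS](contract_mull _ lopid lidH _ _ e) // -[tens_lift _ _]/(mu _) IH.
by rewrite mxE; case: (_ == _); rewrite ?scale1r ?mul1r ?scale0r ?mul0r.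
Qed.

(** The product of [S] and [X], over the tensor product of the opposite algebra
    with the algebra, contracts entrywise to the identity matrix. *)
Lemma qdet_converse : @qdet F N r q H^c S = z.
Proof.
have [RX dz zd] := Xz; have [XS SX] := GL_model_inv r_neq0 q_neq0 q_inv q_diag Xz.
pose SC : 'M[H^c]_N.+1 := S.
pose Y := map_mx (tens_inl nz) SC *m map_mx (tens_inr nz) X.
have muY A B : mu (Y A B) = (A == B)%:R.
  rewrite mxE (lin_sum _ _ _ lmu).
  have /matrixP/(_ A B) := SX; rewrite !mxE => <-.
  by apply: eq_bigr => C _; rewrite !mxE [_ * _]tens_inlr muE.
have dY : qdet r q Y = tens (qdet r q SC) (qdet r q X) :> tensor H^c H.
  rewrite (qdetM r_neq0 q_neq0 q_inv); last first.
  - exact/(RTT_qmatrix r_neq0 q_neq0 q_inv q_diag)/RTT_map.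
  - by move=> A B C D; rewrite !mxE tens_inlrC.
  by rewrite -!qdet_map tens_inlr.
have e : opid (qdet r q SC) * qdet r q X = 1.
  rewrite -muE -dY -(qdet1 r q H) /qdet (lin_sum _ _ _ lmu).
  apply: eq_bigr => s _; have [_ -> _] := linear_lin lmu.
  by rewrite (mu_prod _ muY).
by rewrite -[LHS]/(opid _) -[LHS]mulr1 -dz mulrA e mul1r.
Qed.

Lemma GL_model_converse : @GL_model F N r q H^c S (qdet r q X).
Proof.
have [RX dz zd] := Xz; have [XS SX] := GL_model_inv r_neq0 q_neq0 q_inv q_diag Xz.
by split; [exact: RTT_inv XS SX RX | rewrite qdet_converse..].
Qed.

End ConverseModel.

(** * The Hopf algebra structure *)

Section MkLRMorphism.
Variables (F : fieldType) (A B : algType F) (f : A -> B).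
Hypotheses (lf : linear f) (f1 : f 1 = 1) (fM : {morph f : x y / x * y}).

(** A map with the properties of an algebra morphism, as a morphism. *)
Definition mk_lrmorphism of linear f & f 1 = 1 & {morph f : x y / x * y} :
  A -> B := f.
Local Notation g := (mk_lrmorphism lf f1 fM).
HB.instance Definition _ := GRing.isLinear.Build F A B *:%R g lf.
HB.instance Definition _ :=
  GRing.isMonoidMorphism.Build A B g (f1, fM).

Lemma lrmorphism_of : exists g' : {lrmorphism A -> B}, g' =1 f.
Proof. by exists g. Qed.
End MkLRMorphism.

Section Presented.
Variables (F : fieldType) (N : nat) (r : F) (q : 'I_N.+1 -> 'I_N.+1 -> F).
Hypotheses (r_neq0 : r != 0) (q_neq0 : forall A B, q A B != 0)
  (q_inv : forall A B, q A B = r ^+ 2 / q B A) (q_diag : forall A, q A A = r).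
Local Notation n := N.+1.

(** The algebra [A] is generated by the entries of [T] and by [xi], which form
    the universal model of [GL_{q,r}(N+1)]; under the condition [Z], they form
    the universal model with [T^0_b = 0]. *)
Record presented (Z : Prop) (A : algType F) (T : 'M[A]_n) (xi : A) : Prop :=
  Presented {
  pres_model : GL_model r q T xi;
  pres_row0 : Z -> row0_mx T;
  pres_ind : forall P : A -> Prop, P 1 ->
    (forall x y, P x -> P y -> P (x + y)) -> (forall c x, P x -> P (c *: x)) ->
    (forall x y, P x -> P y -> P (x * y)) -> (forall i j, P (T i j)) -> P xi ->
    forall x, P x;
  pres_univ : forall (B : algType F) (X : 'M[B]_n) (z : B),
    GL_model r q X z -> (Z -> row0_mx X) ->
    exists f : {lrmorphism A -> B}, (forall i j, f (T i j) = X i j) /\ f xi = z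
}.

Section Theory.
Variables (Z : Prop) (A : algType F) (T : 'M[A]_n) (xi : A).
Hypothesis presA : presented Z T xi.
Local Notation S := (qinv q T xi).

Let TS : T *m S = 1%:M.
Proof.
by have [] := GL_model_inv r_neq0 q_neq0 q_inv q_diag (pres_model presA).
Qed.
Let ST : S *m T = 1%:M.
Proof.
by have [] := GL_model_inv r_neq0 q_neq0 q_inv q_diag (pres_model presA).
Qed.

(** Morphisms are determined by the images of the entries of [T]. *)
Lemma pres_ext (B : algType F) (f g : {lrmorphism A -> B}) :
  (forall i j, f (T i j) = g (T i j)) -> f =1 g.
Proof.
move=> fg; apply: (pres_ind presA) => [|x y fx fy|c x fx|x y fx fy||].
- by rewrite !rmorph1.
- by rewrite !raddfD /= fx fy.
- by rewrite !linearZ /= fx.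
- by rewrite !rmorphM /= fx fy.
- exact: fg.
have [_ dx xd] := pres_model presA.
have fd : f (qdet r q T) = g (qdet r q T).
  rewrite !qdet_map; congr qdet; apply/matrixP => i j; rewrite !mxE; exact: fg.
rewrite -[LHS]mulr1 -(rmorph1 g) -dx rmorphM /= mulrA -fd -rmorphM /= xd.
by rewrite rmorph1 mul1r.
Qed.

(** Linear maps can be compared on generators, if agreement is stable under
    products. *)
Lemma pres_lext (V : lmodType F) (f g : A -> V) : linear f -> linear g ->
  f 1 = g 1 -> (forall x y, f x = g x -> f y = g y -> f (x * y) = g (x * y)) ->
  (forall i j, f (T i j) = g (T i j)) -> f xi = g xi -> f =1 g.
Proof.
move=> /linear_lin[fD fZ _] /linear_lin[gD gZ _] fg1 fgM fgT fgx.
apply: (pres_ind presA) => // [x y fx fy|c x fx].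
  by rewrite fD gD fx fy.
by rewrite fZ gZ fx.
Qed.

Lemma pres_counit : exists e : {lrmorphism A -> F^o},
  (forall i j, e (T i j) = (i == j)%:R) /\ e xi = 1.
Proof.
have [_ b|e [eT ex]] := pres_univ presA (GL_model1 r q F^o).
  by rewrite mxE (negPf (neq_lift ord0 b : ord0 != low b)).
by exists e; split=> // i j; rewrite eT mxE.
Qed.

Lemma pres_tens_neq0 : tens 1 1 != 0 :> tensor A A.
Proof.
have [e _] := pres_counit.
have le : linear (e : A -> F^o) by apply: linearP.
have bm := contract_bilinear le le.
apply/eqP => t0; have := tens_liftE bm 1 1; rewrite t0.
have [_ _ ->] := linear_lin (tens_lift_linear bm).
by rewrite rmorph1 mulr1 => /esym/eqP; rewrite oner_eq0.
Qed.
Local Notation nz := pres_tens_neq0.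

(** The coproduct is the model [(T (x) 1) (1 (x) T)]. *)
Lemma pres_coproduct : exists D : {lrmorphism A -> tens_alg nz},
  (forall i j, D (T i j) = \sum_k tens (T i k) (T k j)) /\ D xi = tens xi xi.
Proof.
have mT := pres_model presA; have [_ dx xd] := mT.
have ml := GL_model_map (tens_inl nz) mT.
have mr := GL_model_map (tens_inr nz) mT.
have mX : GL_model r q (map_mx (tens_inl nz) T *m map_mx (tens_inr nz) T)
    (tens xi xi : tens_alg nz).
  apply: (GL_modelM r_neq0 q_neq0 q_inv q_diag _ ml mr).
  - by move=> i j k l; rewrite !mxE tens_inlrC.
  - by rewrite -!qdet_map tens_inlr tens_algM !dx.
  - by rewrite -!qdet_map tens_inlr tens_algM !xd.
have XE i j : (map_mx (tens_inl nz) T *m map_mx (tens_inr nz) T) i j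
    = \sum_k tens (T i k) (T k j).
  by rewrite mxE; apply: eq_bigr => k _; rewrite !mxE tens_inlr.
have [z0 b|D [DT Dx]] := pres_univ presA mX.
  rewrite XE big_ord_recl (pres_row0 presA z0) tens0r add0r big1 // => c _.
  by rewrite [T ord0 _](pres_row0 presA z0) tens0l.
by exists D; split=> // i j; rewrite DT XE.
Qed.

(** The antipode is the model [T^-1] over the opposite algebra. *)
Lemma pres_antipode : exists k : {lrmorphism A -> A^c},
  (forall i j, k (T i j) = S i j) /\ k xi = qdet r q T.
Proof.
have mS := GL_model_converse r_neq0 q_neq0 q_inv q_diag (pres_model presA).
have [z0|k [kT kx]] := pres_univ presA mS; last by exists k.
exact: qinv_row0 (pres_row0 presA z0).
Qed.

End Theory.
End Presented.

Section PresentedHopf.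
Variables (F : fieldType) (N : nat) (r : F) (q : 'I_N.+1 -> 'I_N.+1 -> F).
Hypotheses (r_neq0 : r != 0) (q_neq0 : forall A B, q A B != 0)
  (q_inv : forall A B, q A B = r ^+ 2 / q B A) (q_diag : forall A, q A A = r).
Local Notation n := N.+1.
Variables (Z : Prop) (A : algType F) (T : 'M[A]_n) (xi : A).
Hypothesis presA : presented r q Z T xi.
Local Notation S := (qinv q T xi).
Local Notation nz := (pres_tens_neq0 presA).

Section HopfRules.
Variables (D : {lrmorphism A -> tens_alg nz}) (e : {lrmorphism A -> F^o})
  (k : {lrmorphism A -> A^c}).
Hypotheses (DT : forall i j, D (T i j) = \sum_l tens (T i l) (T l j))
  (Dx : D xi = tens xi xi) (eT : forall i j, e (T i j) = (i == j)%:R)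
  (ex : e xi = 1) (kT : forall i j, k (T i j) = S i j)
  (kx : k xi = qdet r q T).

Let D' : A -> tensor A A := D.
Let k' : A -> A := k.
Let lD : linear D'. Proof. by move=> c x y; exact: (linearP D c x y). Qed.
Let le : linear (e : A -> F^o).
Proof. by move=> c x y; exact: (linearP e c x y). Qed.
Let lk : linear k'. Proof. by move=> c x y; exact: (linearP k c x y). Qed.
Let DM x y : D' (x * y) = tens_mul (D' x) (D' y).
Proof. exact: (rmorphM D). Qed.
Let kM x y : k' (x * y) = k' y * k' x.
Proof. exact: (rmorphM k). Qed.
Let D1 : D' 1 = tens 1 1. Proof. exact: (rmorph1 D). Qed.
Let k1 : k' 1 = 1. Proof. exact: (rmorph1 k). Qed.
Let lidA : linear (id : A -> A). Proof. by []. Qed.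

Let lin_tensl (U V : lmodType F) (v : V) : linear (fun u : U => tens u v).
Proof. exact: (tens_bilinear U V).1. Qed.
Let lin_tensr (U V : lmodType F) (u : U) : linear (fun v : V => tens u v).
Proof. exact: (tens_bilinear U V).2. Qed.

Lemma pres_coassoc x :
  tens_assoc (tens_map D' id (D' x)) = tens_map id D' (D' x).
Proof.
have lDi := tens_map_linear lD lidA; have liD := tens_map_linear lidA lD.
have la := @tens_assoc_linear F A A A.
move: x; apply: (pres_lext presA).
- exact: lin_comp (lin_comp lD lDi) la.
- exact: lin_comp lD liD.
- rewrite D1 (tens_mapE lD lidA) (tens_mapE lidA lD) D1.
  exact: tens_assocE.
- move=> x y ex' ey; rewrite DM.
  have e1 : tens_map D' id (tens_mul (D' x) (D' y))
      = @tens_mul F (tens_alg nz) A (tens_map D' id (D' x))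
          (tens_map D' id (D' y)).
    exact: (tens_mapM (A' := tens_alg nz) _ _ lD lidA).
  have e2 : tens_map id D' (tens_mul (D' x) (D' y))
      = @tens_mul F A (tens_alg nz) (tens_map id D' (D' x))
          (tens_map id D' (D' y)).
    exact: (tens_mapM (B' := tens_alg nz) _ _ lidA lD).
  rewrite e2 -ex' -ey e1; exact: tens_assocM.
- move=> i j; rewrite [D' _]DT (lin_sum _ _ _ lDi) (lin_sum _ _ _ la).
  rewrite (lin_sum _ _ _ liD).
  transitivity (\sum_l \sum_m tens (T i m) (tens (T m l) (T l j))).
    apply: eq_bigr => l _; rewrite (tens_mapE lD lidA) [D' _]DT.
    rewrite (lin_sum _ _ _ (lin_tensl _)) (lin_sum _ _ _ la).
    by apply: eq_bigr => m _; apply: tens_assocE.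
  rewrite exchange_big; apply: eq_bigr => m _.
  by rewrite (tens_mapE lidA lD) [D' _]DT (lin_sum _ _ _ (lin_tensr _)).
- rewrite [D' _]Dx (tens_mapE lD lidA) (tens_mapE lidA lD) [D' _]Dx.
  exact: tens_assocE.
Qed.

Lemma pres_counitl x : tens_lift (fun a b => e a *: b) (D' x) = x.
Proof.
have bl : bilinear2 (fun a b : A => (e a : F) *: b).
  split=> [b|a] c u v; last by rewrite scalerDr !scalerA mulrC.
  by rewrite linearP scalerDl -scalerA.
have ll := tens_lift_linear bl.
move: x; apply: (pres_lext presA).
- exact: lin_comp lD ll.
- exact: lidA.
- by rewrite D1 (tens_liftE bl) rmorph1 scale1r.
- move=> x y ex' ey; rewrite DM (tens_liftM _ _ bl) ?ex' ?ey // => a b a' b'.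
  by rewrite rmorphM -scalerAl -scalerAr scalerA.
- move=> i j; rewrite [D' _]DT (lin_sum _ _ _ ll).
  rewrite (bigD1 i) //= (tens_liftE bl) eT eqxx scale1r big1 ?addr0 // => l.
  by rewrite eq_sym (tens_liftE bl) eT => /negPf ->; rewrite scale0r.
- by rewrite [D' _]Dx (tens_liftE bl) ex scale1r.
Qed.

Lemma pres_counitr x : tens_lift (fun a b => e b *: a) (D' x) = x.
Proof.
have bl : bilinear2 (fun a b : A => (e b : F) *: a).
  split=> [b|a] c u v; first by rewrite scalerDr !scalerA mulrC.
  by rewrite linearP scalerDl -scalerA.
have ll := tens_lift_linear bl.
move: x; apply: (pres_lext presA).
- exact: lin_comp lD ll.
- exact: lidA.
- by rewrite D1 (tens_liftE bl) rmorph1 scale1r.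
- move=> x y ex' ey; rewrite DM (tens_liftM _ _ bl) ?ex' ?ey // => a b a' b'.
  by rewrite rmorphM -scalerAl -scalerAr scalerA.
- move=> i j; rewrite [D' _]DT (lin_sum _ _ _ ll).
  rewrite (bigD1 j) //= (tens_liftE bl) eT eqxx scale1r big1 ?addr0 // => l.
  by rewrite (tens_liftE bl) eT => /negPf ->; rewrite scale0r.
- by rewrite [D' _]Dx (tens_liftE bl) ex scale1r.
Qed.

Let lin_eA : linear (fun x => (e x)%:A : A).
Proof. by move=> c u v; rewrite linearP scalerDl -scalerA. Qed.

Lemma pres_antipodel x : tens_lift (fun a b => k' a * b) (D' x) = (e x)%:A.
Proof.
have bl : bilinear2 (fun a b => k' a * b) := contract_bilinear lk lidA.
have ll := tens_lift_linear bl.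
have [_ dx xd] := pres_model presA.
move: x; apply: (pres_lext presA).
- exact: lin_comp lD ll.
- exact: lin_eA.
- by rewrite D1 (tens_liftE bl) k1 rmorph1 scale1r mulr1.
- move=> x y ex' ey; rewrite DM (contract_mull (g := id) _ lk lidA kM _ ex') // ey.
  by rewrite rmorphM scalerA.
- move=> i j; rewrite [D' _]DT (lin_sum _ _ _ ll) eT.
  have [_ /matrixP/(_ i j)] :=
    GL_model_inv r_neq0 q_neq0 q_inv q_diag (pres_model presA).
  rewrite !mxE (eq_bigr (fun l => tens_lift (fun a b => k' a * b)
    (tens (T i l) (T l j)))) => [->|l _].
    by case: (i == j); rewrite ?scale1r ?scale0r.
  by rewrite (tens_liftE bl) [k' _]kT.
- by rewrite [D' _]Dx (tens_liftE bl) [k' _]kx ex dx scale1r.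
Qed.

Lemma pres_antipoder x : tens_lift (fun a b => a * k' b) (D' x) = (e x)%:A.
Proof.
have bl : bilinear2 (fun a b => a * k' b) := contract_bilinear lidA lk.
have ll := tens_lift_linear bl.
have [_ dx xd] := pres_model presA.
move: x; apply: (pres_lext presA).
- exact: lin_comp lD ll.
- exact: lin_eA.
- by rewrite D1 (tens_liftE bl) k1 rmorph1 scale1r mulr1.
- move=> x y ex' ey; rewrite DM (contract_mulr (f := id) _ lidA lk _ kM ey) // ex'.
  by rewrite rmorphM scalerA mulrC.
- move=> i j; rewrite [D' _]DT (lin_sum _ _ _ ll) eT.
  have [/matrixP/(_ i j) + _] :=
    GL_model_inv r_neq0 q_neq0 q_inv q_diag (pres_model presA).
  rewrite !mxE (eq_bigr (fun l => tens_lift (fun a b => a * k' b)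
    (tens (T i l) (T l j)))) => [->|l _].
    by case: (i == j); rewrite ?scale1r ?scale0r.
  by rewrite (tens_liftE bl) [k' _]kT.
- by rewrite [D' _]Dx (tens_liftE bl) [k' _]kx ex xd scale1r.
Qed.

Lemma pres_is_hopf : is_hopf D' (e : A -> F) k'.
Proof.
split=> //.
- exact: rmorph1.
- exact: rmorphM.
- exact: pres_coassoc.
- exact: pres_counitl.
- exact: pres_counitr.
- exact: pres_antipodel.
- exact: pres_antipoder.
Qed.
End HopfRules.

Lemma pres_hopf : exists (D : A -> tensor A A) (e : A -> F) (k : A -> A),
  [/\ is_hopf D e k, T_costructures T D e k,
      xi_costructures (qdet r q T) xi D e k
    & forall x y, k (x * y) = k y * k x].
Proof.
have [D [DT Dx]] := pres_coproduct r_neq0 q_neq0 q_inv q_diag presA.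
have [e [eT ex]] := pres_counit presA.
have [k [kT kx]] := pres_antipode r_neq0 q_neq0 q_inv q_diag presA.
have [TS ST] := GL_model_inv r_neq0 q_neq0 q_inv q_diag (pres_model presA).
exists D, e, k; split=> //.
- exact: pres_is_hopf.
- by split=> //; exists S.
- exact: (rmorphM k).
Qed.

End PresentedHopf.

(** The antipode is an inverse of the identity for the convolution product. *)
Lemma antipode_unique (F : fieldType) (A : algType F) (D : A -> tensor A A)
    (e : A -> F) (k k' : A -> A) :
  is_hopf D e k -> is_hopf D e k' -> k' =1 k.
Proof.
move=> hk hk' x; have lk := hopf_k_linear hk; have lk' := hopf_k_linear hk'.
have lD := hopf_D_linear hk.
have lid : linear (id : A -> A) by [].
have bl := contract_bilinear lid lk; have bl' := contract_bilinear lk' lid.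
have ll := tens_lift_linear bl; have ll' := tens_lift_linear bl'.
pose psi (a : A) (w : tensor A A) : A :=
  k' a * tens_lift (fun b c => b * k c) w.
have bpsi : bilinear2 psi := contract_bilinear lk' ll.
have lpsi := tens_lift_linear bpsi.
have la := @tens_assoc_linear F A A A.
have lDi := tens_map_linear lD lid; have liD := tens_map_linear lid lD.
(* evaluating k' * id * k by grouping either pair of factors *)
transitivity (tens_lift psi (tens_map id D (D x))).
  transitivity (tens_lift (fun a b => k' a * (e b)%:A) (D x)).
    rewrite -{1}(hopf_counitr hk x) (linear_tens_lift _ _ lk').
    apply: eq_tens_lift => a b; rewrite -scalerAr mulr1.
    by have [_ -> _] := linear_lin lk'.
  have bke : bilinear2 (fun a b => k' a * (e b)%:A).
    apply: contract_bilinear => // c u v.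
    by rewrite (hopf_e_linear hk) scalerDl -scalerA.
  move: (D x); apply: tensor_ext => [||a b].
  - exact: tens_lift_linear.
  - exact: lin_comp liD lpsi.
  rewrite (tens_liftE bke) (tens_mapE lid lD) (tens_liftE bpsi).
  by rewrite /psi (hopf_antipoder hk).
rewrite -(hopf_coassoc hk).
have ble : bilinear2 (fun a b => (e a)%:A * k b).
  apply: contract_bilinear => // c u v.
  by rewrite (hopf_e_linear hk) scalerDl -scalerA.
transitivity (tens_lift (fun a b => (e a)%:A * k b) (D x)); last first.
  rewrite -[in RHS](hopf_counitl hk x) (linear_tens_lift _ _ lk).
  apply: eq_tens_lift => a b; rewrite -scalerAl mul1r.
  by have [_ -> _] := linear_lin lk.
move: (D x); apply: tensor_ext => [||a c].
- exact: lin_comp (lin_comp lDi la) lpsi.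
- exact: tens_lift_linear.
rewrite (tens_liftE ble) (tens_mapE lD lid) -(hopf_antipodel hk' a).
have lt (U V : lmodType F) (v : V) : linear (fun u : U => tens u v).
  exact: (tens_bilinear U V).1.
move: (D a); apply: tensor_ext => [||b c'].
- exact: lin_comp (lin_comp (lt _ _ c) la) lpsi.
- by move=> d u v; rewrite ll' mulrDl -scalerAl.
by rewrite tens_assocE (tens_liftE bpsi) (tens_liftE bl') /psi (tens_liftE bl) mulrA.
Qed.

Section PresentedMorphisms.
Variables (F : fieldType) (N : nat) (r : F) (q : 'I_N.+1 -> 'I_N.+1 -> F).
Local Notation n := N.+1.
Variables (Z : Prop) (A : algType F) (T : 'M[A]_n) (xi : A).
Hypothesis presA : presented r q Z T xi.
Local Notation nz := (pres_tens_neq0 presA).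

Lemma T_costructures_unique D e k D' e' k' :
  is_hopf D e k -> T_costructures T D e k ->
  is_hopf D' e' k' -> T_costructures T D' e' k' ->
  [/\ D' =1 D, e' =1 e & k' =1 k].
Proof.
move=> hk [DT _ eT] hk' [DT' _ eT'].
have [g gE] := lrmorphism_of (B := tens_alg nz)
  (hopf_D_linear hk) (hopf_D1 hk) (hopf_DM hk).
have [g' gE'] := lrmorphism_of (B := tens_alg nz)
  (hopf_D_linear hk') (hopf_D1 hk') (hopf_DM hk').
have [c cE] := lrmorphism_of (B := F^o)
  (hopf_e_linear hk) (hopf_e1 hk) (hopf_eM hk).
have [c' cE'] := lrmorphism_of (B := F^o)
  (hopf_e_linear hk') (hopf_e1 hk') (hopf_eM hk').
have DD : D' =1 D.
  move=> x; rewrite -gE -gE'.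
  have gg i j : g' (T i j) = g (T i j) by rewrite gE gE' DT DT'.
  exact: (pres_ext presA gg x).
have ee : e' =1 e.
  move=> x; rewrite -cE -cE'.
  have cc i j : c' (T i j) = c (T i j) by rewrite cE cE' eT eT'.
  exact: (pres_ext presA cc x).
split=> //; move: hk'; rewrite (funext DD) (funext ee) => hk'.
exact: antipode_unique hk hk'.
Qed.

(** A morphism compatible with the generators respects the co-structures. *)
Lemma hopf_morphism_gen (B : algType F) (T' : 'M[B]_n) (xi' : B)
    (f : {lrmorphism A -> B}) DA eA kA DB eB kB :
  (forall i j, f (T i j) = T' i j) -> f xi = xi' ->
  is_hopf DA eA kA -> T_costructures T DA eA kA ->
  xi_costructures (qdet r q T) xi DA eA kA ->
  is_hopf DB eB kB -> T_costructures T' DB eB kB ->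
  xi_costructures (qdet r q T') xi' DB eB kB ->
  (forall x y, kA (x * y) = kA y * kA x) ->
  (forall x y, kB (x * y) = kB y * kB x) ->
  hopf_morphism DA eA kA DB eB kB f.
Proof.
move=> fT fx hA [DAT [SA [TSA STA kAT]] eAT] [DAx eAx kAx].
move=> hB [DBT [SB [TSB STB kBT]] eBT] [DBx eBx kBx] kAM kBM.
have lf : linear f by exact: linearP.
have lff := tens_map_linear lf lf.
have fM : {morph f : x y / x * y} by exact: rmorphM.
have k1 (C : algType F) D e k : @is_hopf F C D e k -> k 1 = 1.
  move=> hC; have lid : linear (id : C -> C) by [].
  have := hopf_antipodel hC 1; rewrite (hopf_D1 hC) (hopf_e1 hC) scale1r.
  by rewrite (tens_liftE (contract_bilinear (hopf_k_linear hC) lid)) mulr1.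
split.
- apply: (pres_lext presA).
  + exact: lin_comp lf (hopf_D_linear hB).
  + exact: lin_comp (hopf_D_linear hA) lff.
  + by rewrite rmorph1 (hopf_D1 hA) (hopf_D1 hB) (tens_mapE lf lf) rmorph1.
  + move=> x y ex ey; rewrite rmorphM (hopf_DM hA) (hopf_DM hB).
    by rewrite ex ey (tens_mapM _ _ lf lf fM fM).
  + move=> i j; rewrite fT DAT DBT (lin_sum _ _ _ lff); apply: eq_bigr => l _.
    by rewrite (tens_mapE lf lf) !fT.
  + by rewrite fx DAx DBx (tens_mapE lf lf) fx.
- apply: (pres_lext (V := F^o) presA).
  + exact: lin_comp lf (hopf_e_linear hB).
  + exact: hopf_e_linear hA.
  + by rewrite rmorph1 (hopf_e1 hA) (hopf_e1 hB).
  + by move=> x y ex ey; rewrite rmorphM (hopf_eM hA) (hopf_eM hB) ex ey.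
  + by move=> i j; rewrite fT eAT eBT.
  + by rewrite fx eAx eBx.
- apply: (pres_lext presA).
  + exact: lin_comp lf (hopf_k_linear hB).
  + exact: lin_comp (hopf_k_linear hA) lf.
  + by rewrite rmorph1 (k1 _ _ _ _ hA) (k1 _ _ _ _ hB) rmorph1.
  + by move=> x y ex ey; rewrite rmorphM kAM kBM rmorphM ex ey.
  + have fT' : map_mx f T = T' by apply/matrixP => i j; rewrite mxE fT.
    have e1 : map_mx f SA = SB.
      rewrite -[LHS]mulmx1 -TSB mulmxA -fT' -map_mxM STA.
      by rewrite map_scalar_mx rmorph1 mul1mx.
    by move=> i j; rewrite fT kAT kBT -e1 mxE.
  + rewrite fx kAx kBx qdet_map; congr qdet.
    by apply/matrixP => i j; rewrite mxE fT.
Qed.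

End PresentedMorphisms.

(** * The inhomogeneous quantum group *)

(** The relations among [T^a_b], [x^a] and [u], over an arbitrary algebra. *)
Record inhom_mx (F : fieldType) (N : nat) (r : F)
    (q : 'I_N.+1 -> 'I_N.+1 -> F) (H : algType F) (X : 'M[H]_N.+1) : Prop :=
  InhomMx {
  inh_TT : forall a b c d : 'I_N,
    \sum_(e < N) \sum_(f < N) Rmat r q (low a) (low b) (low e) (low f)
      *: (X (low e) (low c) * X (low f) (low d))
    = \sum_(e < N) \sum_(f < N) Rmat r q (low e) (low f) (low c) (low d)
      *: (X (low b) (low f) * X (low a) (low e));
  inh_Tx : forall a b c : 'I_N,
    \sum_(e < N) \sum_(f < N) Rmat r q (low a) (low b) (low e) (low f)
      *: (X (low e) (low c) * X (low f) ord0)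
    = (q ord0 (low c) / r) *: (X (low b) ord0 * X (low a) (low c));
  inh_xx : forall a b : 'I_N,
    \sum_(e < N) \sum_(f < N) Rmat r q (low a) (low b) (low e) (low f)
      *: (X (low e) ord0 * X (low f) ord0)
    = r *: (X (low b) ord0 * X (low a) ord0);
  inh_Tu : forall a c : 'I_N,
    q ord0 (low a) *: (X (low a) (low c) * X ord0 ord0)
    = q ord0 (low c) *: (X ord0 ord0 * X (low a) (low c));
  inh_xu : forall a : 'I_N,
    q ord0 (low a) *: (X (low a) ord0 * X ord0 ord0)
    = X ord0 ord0 * X (low a) ord0
}.

Section Inhomogeneous.
Variables (F : fieldType) (N : nat) (r : F) (q : 'I_N.+1 -> 'I_N.+1 -> F).
Hypotheses (r_neq0 : r != 0) (q_neq0 : forall A B, q A B != 0)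
  (q_inv : forall A B, q A B = r ^+ 2 / q B A) (q_diag : forall A, q A A = r).
Variables (H : algType F) (X : 'M[H]_N.+1).
Hypothesis X0 : row0_mx X.

Let low0 (a : 'I_N) : (low a == ord0) = false.
Proof. by rewrite eq_sym; apply/negbTE/neq_lift. Qed.
Let low_eq (a b : 'I_N) : (a == b) = (low a == low b).
Proof. by rewrite (inj_eq lift_inj). Qed.
Let qr A : r / q A A + (r - 1) * true%:R = r.
Proof. by rewrite q_diag divff // mulr1 addrC subrK. Qed.
(* the coefficient of the part of [R] that keeps the order of the indices *)
Let al A B : F := r / q A B + (r - 1) * (A == B)%:R.
Let alr A : al A A = r. Proof. by rewrite /al eqxx qr. Qed.
Let al_neq A B : (A == B) = false -> al A B = r / q A B.
Proof. by rewrite /al => ->; rewrite mulr0 addr0. Qed.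
Let al0l a : al ord0 (low a) = r / q ord0 (low a).
Proof. by rewrite al_neq // eq_sym low0. Qed.
Let al0r a : al (low a) ord0 = q ord0 (low a) / r.
Proof.
rewrite al_neq ?low0 // (q_inv (low a)).
by field; rewrite ?r_neq0 ?q_neq0.
Qed.
Let sumL (h : 'I_N -> 'I_N -> H) a b :
  \sum_(e < N) \sum_(f < N) Rmat r q (low a) (low b) (low e) (low f) *: h e f
  = al (low a) (low b) *: h a b
    + ((r - r^-1) * (low b < low a)%N%:R) *: h b a.
Proof. by rewrite (Rmat_suml r q h lift_inj) low_eq. Qed.
Let sumR (h : 'I_N -> 'I_N -> H) c d :
  \sum_(e < N) \sum_(f < N) Rmat r q (low e) (low f) (low c) (low d) *: h e f
  = al (low c) (low d) *: h c d
    + ((r - r^-1) * (low c < low d)%N%:R) *: h d c.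
Proof. by rewrite (Rmat_sumr r q h lift_inj) low_eq. Qed.
Let low_gt0 (a : 'I_N) : ((ord0 : 'I_N.+1) < low a)%N. Proof. by []. Qed.
Let low_lt0 (a : 'I_N) : (low a < (ord0 : 'I_N.+1))%N = false. Proof. by []. Qed.

Lemma RTT_inhom : RTT_mx r q X -> inhom_mx r q X.
Proof.
move/RTT_mxE; rewrite -/al => e; split=> [a b c d|a b c|a b|a c|a].
- by rewrite sumL sumR; apply: e.
- rewrite sumL; apply: etrans (e (low a) (low b) (low c) ord0) _.
  rewrite low_lt0 low0 !mulr0 scale0r !addr0; congr (_ *: _).
  by rewrite q_inv; field; rewrite ?r_neq0 ?q_neq0.
- rewrite sumL; apply: etrans (e (low a) (low b) ord0 ord0) _.
  by rewrite eqxx qr ltnn mulr0 scale0r addr0.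
- have := e ord0 (low a) ord0 (low c).
  rewrite [ord0 == low a]eq_sym [ord0 == low c]eq_sym !low0 X0 !mulr0.
  rewrite !scaler0 !addr0 => e'; symmetry.
  by apply: (scale_eq2 (k := q ord0 (low a) * q ord0 (low c) / r) e'); field;
    rewrite ?r_neq0 ?q_neq0.
- have := e ord0 (low a) ord0 ord0.
  rewrite low_lt0 [ord0 == low a]eq_sym low0 eqxx qr ltnn !mulr0 !scale0r !addr0.
  move=> e'.
  symmetry; rewrite -[LHS]scale1r.
  by apply: (scale_eq2 (k := q ord0 (low a) / r) e'); field;
    rewrite ?r_neq0 ?q_neq0.
Qed.

Lemma inhom_RTT : inhom_mx r q X -> RTT_mx r q X.
Proof.
case=> TT Tx xx Tu xu; apply/RTT_mxE => A B C D.
have {}TT a b c d := etrans (esym (sumL _ a b)) (etrans (TT a b c d) (sumR _ c d)).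
have {}Tx a b c := etrans (esym (sumL _ a b)) (Tx a b c).
have {}xx a b := etrans (esym (sumL _ a b)) (xx a b).
rewrite -/(al A B) -/(al C D).
case: (unliftP ord0 A) => [a|] ->; case: (unliftP ord0 B) => [b|] ->;
  case: (unliftP ord0 C) => [c|] ->; case: (unliftP ord0 D) => [d|] ->;
  rewrite -?/(low a) -?/(low b) -?/(low c) -?/(low d) ?low_lt0 ?low_gt0 ?ltnn;
  rewrite ?X0 ?mulr0 ?mul0r ?scaler0 ?scale0r ?addr0 ?add0r ?mulr1 ?alr //.
(* there remain the index patterns with a nonzero term *)
- by rewrite Tx al0r.
(* the rules between [x^a] and [T^b_d], solved for [x^a T^b_d] *)
- rewrite al0l; case: (ltngtP a b) => [ab|ba|/ord_inj <-].
  + have lab : (low a < low b)%N by [].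
    have e1 := Tx a b d; have e2 := Tx b a d.
    have ba0 : (low b < low a)%N = false by rewrite ltnNge (ltnW lab).
    have nab : (low a == low b) = false by apply: ltn_eqF.
    have nba : (low b == low a) = false by rewrite eq_sym.
    rewrite ba0 mulr0 scale0r addr0 (al_neq nab) in e1.
    rewrite lab mulr1 (al_neq nba) in e2.
    rewrite ba0 mulr0 scale0r addr0 (al_neq nab).
    have -> : X (low b) ord0 * X (low a) (low d)
        = (r ^+ 2 / (q ord0 (low d) * q (low a) (low b)))
          *: (X (low a) (low d) * X (low b) ord0).
      rewrite -[LHS]scale1r.
      by apply: (scale_eq2 (k := r / q ord0 (low d)) (esym e1)); field;
        rewrite ?r_neq0 ?q_neq0.
    rewrite scalerA.
    apply: (scale_eq3
      (k := r ^+ 2 / (q ord0 (low d) * q (low a) (low b))) (esym e2)).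
    * by field; rewrite ?r_neq0 ?q_neq0.
    * by rewrite (q_inv (low b)); field; rewrite ?r_neq0 ?q_neq0.
    * by rewrite mulrC.
  + have lba : (low b < low a)%N by [].
    have e2 := Tx b a d.
    have ab0 : (low a < low b)%N = false by rewrite ltnNge (ltnW lba).
    have nba : (low b == low a) = false by apply: ltn_eqF.
    have nab : (low a == low b) = false by rewrite eq_sym.
    rewrite ab0 mulr0 scale0r addr0 (al_neq nba) in e2.
    rewrite lba mulr1 (al_neq nab); congr (_ + _).
    apply: (scale_eq2
      (k := r ^+ 2 / (q ord0 (low d) * q (low a) (low b))) (esym e2)).
    * by field; rewrite ?r_neq0 ?q_neq0.
    * by rewrite (q_inv (low b)); field; rewrite ?r_neq0 ?q_neq0.
  + have e1 := Tx a a d; rewrite ltnn mulr0 scale0r addr0 alr in e1 *.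
    apply/eqP; rewrite scale0r addr0 -subr_eq -scalerBl; apply/eqP.
    by apply: (scale_eq2 (k := q (low d) ord0 / r ^+ 2) (esym e1));
      rewrite (q_inv (low d)); field; rewrite ?r_neq0 ?q_neq0.
- rewrite !al0r; apply: (scale_eq2 (k := r^-1) (Tu a c)); exact: mulrC.
- rewrite al0r -xu scalerA scalerA -scalerDl; congr (_ *: _).
  by field.
- rewrite !al0l; apply: (scale_eq2
    (k := r / (q ord0 (low b) * q ord0 (low d))) (esym (Tu b d))).
  + by field; rewrite ?r_neq0 ?q_neq0.
  + by field; rewrite ?r_neq0 ?q_neq0.
- rewrite al0l -xu scalerA; congr (_ *: _).
  by field; rewrite ?r_neq0 ?q_neq0.
Qed.
End Inhomogeneous.

Section Presentations.
Variables (F : fieldType) (N : nat) (r : F) (q : 'I_N.+1 -> 'I_N.+1 -> F).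
Hypotheses (r_neq0 : r != 0) (q_neq0 : forall A B, q A B != 0)
  (q_inv : forall A B, q A B = r ^+ 2 / q B A) (q_diag : forall A, q A A = r).
Local Notation n := N.+1.
Local Notation FA := (freealg F (qgens N)).

Lemma sum2_map (H H' : algType F) (f : {lrmorphism H -> H'}) (m : nat)
    (c : 'I_m -> 'I_m -> F) (u v : 'I_m -> 'I_m -> H) :
  f (\sum_(e < m) \sum_(g < m) c e g *: (u e g * v e g))
  = \sum_(e < m) \sum_(g < m) c e g *: (f (u e g) * f (v e g)).
Proof.
rewrite raddf_sum; apply: eq_bigr => e _; rewrite raddf_sum.
by apply: eq_bigr => g _; rewrite /= linearZ /= rmorphM.
Qed.

Section Map.
Variables (H : algType F) (f : {lrmorphism FA -> H}).
Local Notation X := (map_mx f (freeT F N)).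
Local Notation z := (f (freexi F N)).

Let fT A B : f (freeT F N A B) = X A B. Proof. by rewrite [RHS]mxE. Qed.
Let fqdet : f (qdet r q (freeT F N)) = qdet r q X.
Proof. exact: qdet_map. Qed.

(** A morphism from the free algebra satisfies a set of relations exactly when
    the images of the generators do. *)
Lemma det_relP : (forall x y, det_rel r q x y -> f x = f y) <->
  qdet r q X * z = 1 /\ z * qdet r q X = 1.
Proof.
have fdx : f (qdet r q (freeT F N) * freexi F N) = qdet r q X * z.
  by rewrite rmorphM /= fqdet.
have fxd : f (freexi F N * qdet r q (freeT F N)) = z * qdet r q X.
  by rewrite rmorphM /= fqdet.
split=> [rel|[dz zd] x y [|]].
- split; first exact: etrans (esym fdx) (etrans (rel _ _ (det_xi r q)) (rmorph1 f)).
  exact: etrans (esym fxd) (etrans (rel _ _ (xi_det r q)) (rmorph1 f)).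
- exact: etrans fdx (etrans dz (esym (rmorph1 f))).
- exact: etrans fxd (etrans zd (esym (rmorph1 f))).
Qed.

Let f_sum2 m c (A B C D : 'I_m -> 'I_m -> 'I_n) :
  f (\sum_(e < m) \sum_(g < m)
       c e g *: (freeT F N (A e g) (B e g) * freeT F N (C e g) (D e g)))
  = \sum_(e < m) \sum_(g < m) c e g *: (X (A e g) (B e g) * X (C e g) (D e g)).
Proof.
apply: etrans (sum2_map f c _ _) _.
by apply: eq_bigr => e _; apply: eq_bigr => g _; rewrite !fT.
Qed.

Lemma RTT_relP :
  (forall x y, RTT_rel r q x y -> f x = f y) <-> RTT_mx r q X.
Proof.
have l A B C D := f_sum2 (fun E G => Rmat r q A B E G)
  (fun E _ => E) (fun _ _ => C) (fun _ G => G) (fun _ _ => D).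
have l' A B C D := f_sum2 (fun E G => Rmat r q E G C D)
  (fun _ _ => B) (fun _ G => G) (fun _ _ => A) (fun E _ => E).
split=> [rel A B C D|rel x y [A B C D]].
  exact: etrans (esym (l _ _ _ _)) (etrans (rel _ _ (RTT r q A B C D)) (l' _ _ _ _)).
exact: etrans (l _ _ _ _) (etrans (rel A B C D) (esym (l' _ _ _ _))).
Qed.

Lemma row0_relP :
  (forall x y, @row0_rel F N x y -> f x = f y) <-> row0_mx X.
Proof.
split=> [rel b|rel x y [b]]; last by rewrite fT rel raddf0.
by rewrite -fT -(raddf0 f); apply: rel.
Qed.

Lemma inhom_relP :
  (forall x y, inhom_rel r q x y -> f x = f y) <-> inhom_mx r q X.
Proof.
have fZ c A B C D : f (c *: (freeT F N A B * freeT F N C D))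
    = c *: (X A B * X C D) by rewrite linearZ /= rmorphM /= !fT.
have tt a b c d := f_sum2 (fun e g => Rmat r q (low a) (low b) (low e) (low g))
  (fun e _ => low e) (fun _ _ => c) (fun _ g => low g) (fun _ _ => d).
have tt' a b c d := f_sum2 (fun e g => Rmat r q (low e) (low g) (low c) (low d))
  (fun _ _ => low b) (fun _ g => low g) (fun _ _ => low a) (fun e _ => low e).
split=> [rel|[TT Tx xx Tu xu] x y].
  split=> [a b c d|a b c|a b|a c|a].
  - exact: etrans (esym (tt _ _ _ _))
      (etrans (rel _ _ (inhom_TT r q a b c d)) (tt' a b c d)).
  - exact: etrans (esym (tt _ _ _ _))
      (etrans (rel _ _ (inhom_Tx r q a b c)) (fZ _ _ _ _ _)).
  - exact: etrans (esym (tt _ _ _ _))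
      (etrans (rel _ _ (inhom_xx r q a b)) (fZ _ _ _ _ _)).
  - exact: etrans (esym (fZ _ _ _ _ _))
      (etrans (rel _ _ (inhom_Tu r q a c)) (fZ _ _ _ _ _)).
  - apply: etrans (esym (fZ _ _ _ _ _)) (etrans (rel _ _ (inhom_xu r q a)) _).
    by rewrite rmorphM /= !fT.
case=> [a b c d|a b c|a b|a c|a].
- exact: etrans (tt _ _ _ _) (etrans (TT a b c d) (esym (tt' _ _ _ _))).
- exact: etrans (tt _ _ _ _) (etrans (Tx a b c) (esym (fZ _ _ _ _ _))).
- exact: etrans (tt _ _ _ _) (etrans (xx a b) (esym (fZ _ _ _ _ _))).
- exact: etrans (fZ _ _ _ _ _) (etrans (Tu a c) (esym (fZ _ _ _ _ _))).
- by rewrite fZ rmorphM /= !fT xu.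
Qed.

Lemma GL_relP : (forall x y, GL_rel r q x y -> f x = f y) <->
  GL_model r q X z.
Proof.
split=> [rel|[R dz zd] x y [xy|xy]].
- have /RTT_relP R : forall x y, RTT_rel r q x y -> f x = f y.
    by move=> x y xy; apply: rel; right.
  by have /det_relP[] : forall x y, det_rel r q x y -> f x = f y;
    first by move=> x y xy; apply: rel; left.
- by move: x y xy; apply/det_relP.
- by move: x y xy; apply/RTT_relP.
Qed.

Lemma IGL_RTT_relP : (forall x y, IGL_RTT_rel r q x y -> f x = f y) <->
  GL_model r q X z /\ row0_mx X.
Proof.
split=> [rel|[[R dz zd] X0] x y [xy|xy|xy]].
- have /RTT_relP R : forall x y, RTT_rel r q x y -> f x = f y.
    by move=> x y xy; apply: rel; apply: Or33.
  have /row0_relP X0 : forall x y, @row0_rel F N x y -> f x = f y.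
    by move=> x y xy; apply: rel; apply: Or32.
  have /det_relP[dz zd] : forall x y, det_rel r q x y -> f x = f y.
    by move=> x y xy; apply: rel; apply: Or31.
  by split; first by split.
- by move: x y xy; apply/det_relP.
- by move: x y xy; apply/row0_relP.
- by move: x y xy; apply/RTT_relP.
Qed.

Lemma IGL_relP : (forall x y, IGL_rel r q x y -> f x = f y) <->
  GL_model r q X z /\ row0_mx X.
Proof.
split=> [rel|[[R dz zd] X0] x y [xy|xy|xy]].
- have /inhom_relP R : forall x y, inhom_rel r q x y -> f x = f y.
    by move=> x y xy; apply: rel; apply: Or33.
  have /row0_relP X0 : forall x y, @row0_rel F N x y -> f x = f y.
    by move=> x y xy; apply: rel; apply: Or32.
  have /det_relP[dz zd] : forall x y, det_rel r q x y -> f x = f y.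
    by move=> x y xy; apply: rel; apply: Or31.
  by split=> //; split=> //; apply: inhom_RTT.
- by move: x y xy; apply/det_relP.
- by move: x y xy; apply/row0_relP.
- by move: x y xy; apply/inhom_relP/RTT_inhom.
Qed.
End Map.

(** A quotient of the free algebra by relations equivalent to those of models
    is presented by these models. *)
Lemma quot_presented (Z : Prop) (rel : FA -> FA -> Prop)
    (proper : ~ ideal (rel_gens rel) 1) :
  (forall (H : algType F) (f : {lrmorphism FA -> H}),
     (forall x y, rel x y -> f x = f y) <->
     GL_model r q (map_mx f (freeT F N)) (f (freexi F N))
     /\ (Z -> row0_mx (map_mx f (freeT F N)))) ->
  presented r q Z (map_mx (alg_pi proper) (freeT F N))
    (alg_pi proper (freexi F N)).
Proof.
move=> relP.
have [mT T0] : GL_model r q (map_mx (alg_pi proper) (freeT F N))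
    (alg_pi proper (freexi F N))
    /\ (Z -> row0_mx (map_mx (alg_pi proper) (freeT F N))).
  apply: (relP _ (alg_pi proper)).1 => x y xy; apply/span_piP.
  apply: span_gen; exists 1, (x - y), 1; rewrite mul1r mulr1; split=> //.
  by exists x, y.
split=> //.
- move=> P P1 PD PZ PM PT Pxi u; have [x <-] := alg_pi_surj u.
  elim/freealg_ind: x => [|x y Px Py|c x Px|x y Px Py|[[A B]|]] //.
  + by rewrite raddfD; apply: PD.
  + by rewrite linearZ; apply: PZ.
  + by rewrite rmorphM; apply: PM.
  + by have := PT A B; rewrite !mxE.
- move=> B X z mX X0.
  pose h (x : qgens N) : B := if x is Some AB then X AB.1 AB.2 else z.
  have hT : map_mx (free_lift h) (freeT F N) = X.
    by apply/matrixP => i j; rewrite !mxE free_lift_gen.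
  have hx : free_lift h (freexi F N) = z by rewrite free_lift_gen.
  rewrite -hx in mX.
  have f0 x : rel_gens rel x -> free_lift h x = 0.
    case=> a [b [ab ->]]; rewrite raddfB; apply/eqP; rewrite subr_eq0; apply/eqP.
    by move: a b ab; apply: (relP B (free_lift h)).2; rewrite hT; split.
  have [f fE] := alg_quot_lift proper f0.
  exists f; split=> [i j|]; last exact: etrans (fE _) hx.
  by rewrite mxE fE -[in RHS]hT [RHS]mxE.
Qed.

Lemma GL_presented : presented r q False (GL_T r q) (GL_xi r q).
Proof.
apply: quot_presented => H f; split=> [/GL_relP|[m _]]; first by [].
exact/GL_relP.
Qed.

Lemma IGL_presented : presented r q True (IGL_T r q) (IGL_xi r q).
Proof.
apply: quot_presented => H f; split=> [/IGL_relP[]|[m X0]]; first by [].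
by apply/IGL_relP; split=> //; apply: X0.
Qed.

Lemma IGL_RTT_presented :
  presented r q True (IGL_RTT_T r q) (IGL_RTT_xi r q).
Proof.
apply: quot_presented => H f; split=> [/IGL_RTT_relP[]|[m X0]]; first by [].
by apply/IGL_RTT_relP; split=> //; apply: X0.
Qed.

(** Two algebras with the same universal property are isomorphic. *)
Lemma presented_iso Z (A B : algType F) (T : 'M[A]_n) xi (T' : 'M[B]_n) xi' :
  presented r q Z T xi -> presented r q Z T' xi' ->
  exists phi : {lrmorphism A -> B},
    [/\ bijective phi, forall i j, phi (T i j) = T' i j & phi xi = xi'].
Proof.
move=> pA pB.
have [f [fT fx]] := pres_univ pA (pres_model pB) (pres_row0 pB).
have [g [gT gx]] := pres_univ pB (pres_model pA) (pres_row0 pA).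
exists f; split=> //; exists g.
- have gf : g \o f =1 (idfun : A -> A).
    apply: (pres_ext pA) => i j /=; by rewrite fT gT.
  exact: gf.
- have fg : f \o g =1 (idfun : B -> B).
    apply: (pres_ext pB) => i j /=; by rewrite gT fT.
  exact: fg.
Qed.

(** The projection of the universal model onto the universal model with
    [T^0_b = 0] is onto, with kernel generated by the [T^0_b]. *)
Lemma presented_proj (A B : algType F) (T : 'M[A]_n) xi (T' : 'M[B]_n) xi' :
  presented r q False T xi -> presented r q True T' xi' ->
  exists pi : {lrmorphism A -> B},
    [/\ forall i j, pi (T i j) = T' i j, pi xi = xi',
        forall y, exists x, pi x = y
      & forall x, pi x = 0 <->
          ideal (fun u => exists b : 'I_N, u = T ord0 (low b)) x].
Proof.
move=> pA pB; set J : A -> Prop := fun u => exists b : 'I_N, u = T ord0 (low b).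
have [pi [piT pix]] := pres_univ pA (pres_model pB) (fun f => False_ind _ f).
have piJ x : J x -> pi x = 0.
  by case=> b ->; rewrite piT (pres_row0 pB).
have proper : ~ ideal J 1.
  move/(ideal_lrmorphism piJ)/eqP; by rewrite rmorph1 oner_eq0.
exists pi; split=> //.
- apply: (pres_ind pB).
  + by exists 1; rewrite rmorph1.
  + by move=> _ _ [x <-] [y <-]; exists (x + y); rewrite raddfD.
  + by move=> c _ [x <-]; exists (c *: x); rewrite linearZ.
  + by move=> _ _ [x <-] [y <-]; exists (x * y); rewrite rmorphM.
  + by move=> i j; exists (T i j).
  + by exists xi.
- move=> x; split=> [px|]; last exact: ideal_lrmorphism.
  have mJ := GL_model_map (alg_pi proper) (pres_model pA).
  have [_ b|g [gT gx]] := pres_univ pB mJ.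
    rewrite mxE; apply/alg_pi_eq0; apply: span_gen; exists 1, (T ord0 (low b)), 1.
    by rewrite mul1r mulr1; split=> //; exists b.
  have gpi : g \o pi =1 alg_pi proper.
    by apply: (pres_ext pA) => i j /=; rewrite piT gT mxE.
  by apply/(alg_pi_eq0 proper); rewrite -gpi /= px raddf0.
Qed.

End Presentations.
Theorem theorem3p3p2 (R : realType) (N : nat) (r : complex R)
    (q : 'I_N.+1 -> 'I_N.+1 -> complex R)
    (r_neq0 : r != 0)
    (q_neq0 : forall A B, q A B != 0)
    (q_inv : forall A B, q A B = r ^+ 2 / q B A)
    (q_diag : forall A, q A A = r) :
  (* IGL is presented by the RTT relations together with T^0_b = 0 *)
  (exists phi : {lrmorphism IGL_RTT r q -> IGL r q},
     [/\ bijective phi,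
         forall A B, phi (IGL_RTT_T r q A B) = IGL_T r q A B
       & phi (IGL_RTT_xi r q) = IGL_xi r q])
  /\
  (* the co-structures of IGL, as a quotient Hopf algebra of GL *)
  (exists (DG : GL r q -> tensor (GL r q) (GL r q))
          (eG : GL r q -> complex R) (kG : GL r q -> GL r q),
     [/\ is_hopf DG eG kG,
         T_costructures (GL_T r q) DG eG kG,
         xi_costructures (qdet r q (GL_T r q)) (GL_xi r q) DG eG kG
       & exists pi : {lrmorphism GL r q -> IGL r q},
           [/\ forall A B, pi (GL_T r q A B) = IGL_T r q A B,
               pi (GL_xi r q) = IGL_xi r q,
               forall y, exists x, pi x = y,
               forall x, pi x = 0 <->
                 ideal (fun z => exists b : 'I_N, z = GL_T r q ord0 (low b)) x
             & exists (D : IGL r q -> tensor (IGL r q) (IGL r q))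
                      (e : IGL r q -> complex R) (k : IGL r q -> IGL r q),
                 [/\ is_hopf D e k,
                     hopf_morphism DG eG kG D e k pi,
                     T_costructures (IGL_T r q) D e k,
                     xi_costructures (qdet r q (IGL_T r q)) (IGL_xi r q) D e k
                   & forall D' e' k', is_hopf D' e' k' ->
                       T_costructures (IGL_T r q) D' e' k' ->
                       [/\ D' =1 D, e' =1 e & k' =1 k]]]]).
Proof.
have pG := GL_presented r q.
have pI := IGL_presented r_neq0 q_neq0 q_inv q_diag.
have pR := IGL_RTT_presented r q.
split; first exact: presented_iso pR pI.
have [DG [eG [kG [hG TG xG kGM]]]] := pres_hopf r_neq0 q_neq0 q_inv q_diag pG.
have [D [e [k [hI TI xI kM]]]] := pres_hopf r_neq0 q_neq0 q_inv q_diag pI.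
have [pi [piT pix pi_surj pi_ker]] := presented_proj pG pI.
exists DG, eG, kG; split=> //; exists pi; split=> //; exists D, e, k; split=> //.
- exact: (hopf_morphism_gen pG piT pix hG TG xG hI TI xI kGM kM).
- by move=> D' e' k'; apply: (T_costructures_unique pI hI TI).
Qed.
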